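(* Let $q=p^r$ with $p$ prime, let $s>1$, $n>1$ and $1\le k\le n-1$ be integers, and let $\sigma$ be a generator of $\mathrm{Gal}(\mathbb F_{q^n}/\mathbb F_q)$. Let $\varepsilon_n=1$ if $n>2$ and $\varepsilon_n=2$ if $n=2$. Consider the codes $\mathcal S_k(F)$, $F\in\mathcal I_{q,s}$, obtained from $\mathbb F_{q^n}[X;\sigma]$. (1) The number of pairwise linearly inequivalent codes $\mathcal S_k(F)$ (i.e. the number of linear equivalence classes among them) is exactly the number of $\mathcal G$-orbits on $\mathcal I_{q,s}$. In particular, it is at least $\left\lceil \dfrac{|\mathcal I_{q,s}|}{\varepsilon_n(q-1)}\right\rceil$. (2) The number of pairwise $\Gamma$-inequivalent codes $\mathcal S_k(F)$ (i.e. the number of $\Gamma$-equivalence classes among them) is exactly the number of $\widehat{\mathcal G}$-orbits on $\mathcal I_{q,s}$. In particular, it is at least $\left\lceil \dfrac{|\mathcal I_{q,s}|}{\varepsilon_n r(q-1)}\right\rceil$.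
   Context: $\mathcal I_{q,s}$ is the set of monic irreducible polynomials of degree $s$ in $\mathbb F_q[Y]$. Group actions on $\mathcal I_{q,s}$: $(\lambda,\tau)\in\mathbb F_q^\times\rtimes\mathrm{Gal}(\mathbb F_q/\mathbb F_p)$ acts by $(\lambda,\tau)\cdot F:=\lambda^sF^\tau(\lambda^{-1}Y)$, where $F^\tau$ is obtained by applying $\tau$ to the coefficients of $F$; $\iota$ is the reciprocal involution $\iota(F)=\widehat F$, $\widehat F(Y):=F(0)^{-1}Y^sF(Y^{-1})$. Put $\mathcal G=\mathbb F_q^\times$ if $n>2$, $\mathcal G=\mathbb F_q^\times\rtimes\langle\iota\rangle$ if $n=2$ (where $\iota$ inverts $\mathbb F_q^\times$), and $\widehat{\mathcal G}=\mathcal G\rtimes\mathrm{Gal}(\mathbb F_q/\mathbb F_p)$, acting on $\mathcal I_{q,s}$ as follows: $\lambda\in\mathbb F_q^\times$ acts by $F\mapsto\lambda^sF(\lambda^{-1}Y)$, $\tau\in\mathrm{Gal}(\mathbb F_q/\mathbb F_p)$ acts by $F\mapsto F^\tau$, and (when $n=2$) $\iota$ acts by $F\mapsto\widehat F$. $R=\mathbb F_{q^n}[X;\sigma]$ is the skew polynomial ring with $X\alpha=\sigma(\alpha)X$. For $F\in\mathcal I_{q,s}$, $RF(X^n)$ is a two-sided ideal and $R_F:=R/RF(X^n)$ has center $\mathbb E_F\cong\mathbb F_q[Y]/(F)\cong\mathbb F_{q^s}$ and is isomorphic to $M_n(\mathbb F_{q^s})$. The code is $\mathcal S_k(F):=\{\sum_{i=0}^{sk-1}\alpha_iX^i+RF(X^n):\alpha_i\in\mathbb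 F_{q^n}\}\subseteq R_F$. Subsets $\mathcal D,\mathcal D'\subseteq M_n(\mathbb F_{q^s})$ are $\Gamma$-equivalent if $\mathcal D'=U\mathcal D^\rho V$ with $U,V\in\mathrm{GL}_n(\mathbb F_{q^s})$ and $\rho\in\mathrm{Aut}(\mathbb F_{q^s})$ acting entrywise, and linearly equivalent if one may take $\rho=\mathrm{id}$. The codes $\mathcal S_k(F)$ and $\mathcal S_k(G)$ are linearly equivalent (resp. $\Gamma$-equivalent) if there are $\mathbb F_q$-algebra isomorphisms $R_F\to M_n(\mathbb F_{q^s})$ and $R_G\to M_n(\mathbb F_{q^s})$ under which their images are linearly equivalent (resp. $\Gamma$-equivalent). *)

(* Defs.v *)
From HB Require Import structures.
From mathcomp Require Import all_boot all_order all_algebra all_fingroup.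
From mathcomp Require Import all_solvable all_field qpoly.
From mathcomp Require Import boolp classical_sets ring zify.

Set Implicit Arguments.
Unset Strict Implicit.
Unset Printing Implicit Defensive.

Import GRing.Theory.
Local Open Scope ring_scope.

(* Quotient of a possibly noncommutative ring by a two-sided ideal; the library
   only equips quotients of commutative rings with a ring structure. *)
Section TwoSidedQuotient.

Variables (R : nzRingType) (I : zmodClosed R).
Hypothesis I_left : forall a x : R, x \in I -> a * x \in I.
Hypothesis I_right : forall a x : R, x \in I -> x * a \in I.

Definition ts_quot of (forall a x : R, x \in I -> a * x \in I)
  & (forall a x : R, x \in I -> x * a \in I) : Type := Quotient.quot I.
Local Notation Q := (ts_quot I_left I_right).

HB.instance Definition _ := GRing.Zmodule.copy Q (Quotient.quot I).

Definition ts_pi (x : R) : Q := (\pi_(Quotient.quot I) x)%qT.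

Fact ts_pi_is_zmod_morphism : zmod_morphism ts_pi.
Proof. exact: (raddfB (\pi_(Quotient.quot I))%qT). Qed.

HB.instance Definition _ :=
  GRing.isZmodMorphism.Build R Q ts_pi ts_pi_is_zmod_morphism.

Definition ts_repr (x : Q) : R := generic_quotient.repr (x : Quotient.quot I).

Lemma ts_reprK : cancel ts_repr ts_pi.
Proof. by move=> x; rewrite /ts_pi /ts_repr generic_quotient.reprK. Qed.

Lemma ts_pi_eq (x y : R) : (ts_pi x == ts_pi y) = (x - y \in I).
Proof. by rewrite Quotient.idealrBE. Qed.

Definition ts_mul (x y : Q) : Q := ts_pi (ts_repr x * ts_repr y).

Lemma ts_piM (x y : R) : ts_pi (x * y) = ts_mul (ts_pi x) (ts_pi y).
Proof.
apply/eqP; rewrite ts_pi_eq.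
have h z : z - ts_repr (ts_pi z) \in I by rewrite -ts_pi_eq ts_reprK.
rewrite -[_ * _](addrNK (x * ts_repr (ts_pi y))) -mulrBr -addrA -mulrBl.
by apply: rpredD; [exact/I_left/h | exact/I_right/h].
Qed.

Fact ts_mulA : associative ts_mul.
Proof.
move=> x y z; rewrite -[x]ts_reprK -[y]ts_reprK -[z]ts_reprK.
by rewrite -!ts_piM mulrA.
Qed.

Fact ts_mul1 : left_id (ts_pi 1) ts_mul.
Proof. by move=> x; rewrite -[x]ts_reprK -ts_piM mul1r. Qed.

Fact ts_mulr1 : right_id (ts_pi 1) ts_mul.
Proof. by move=> x; rewrite -[x]ts_reprK -ts_piM mulr1. Qed.

Fact ts_mulDl : left_distributive ts_mul +%R.
Proof.
move=> x y z; rewrite -[x]ts_reprK -[y]ts_reprK -[z]ts_reprK.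
by rewrite -raddfD -!ts_piM mulrDl raddfD.
Qed.

Fact ts_mulDr : right_distributive ts_mul +%R.
Proof.
move=> x y z; rewrite -[x]ts_reprK -[y]ts_reprK -[z]ts_reprK.
by rewrite -raddfD -!ts_piM mulrDr raddfD.
Qed.

HB.instance Definition _ := GRing.Zmodule_isPzRing.Build Q
  ts_mulA ts_mul1 ts_mulr1 ts_mulDl ts_mulDr.

HB.instance Definition _ := GRing.isMonoidMorphism.Build R Q ts_pi
  (conj (erefl _) ts_piM).

End TwoSidedQuotient.

(* The skew polynomial ring L[X; theta]: the left L-module of {poly L}, with
   the multiplication determined by (a X^i) q = a theta^i(q) X^i, where theta
   acts on coefficients. *)
Record skewpoly (L : fieldType) (theta : {rmorphism L -> L}) : predArgType :=
  SkewPoly { skew_val : {poly L} }.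

Section SkewPoly.

Variables (L : fieldType) (theta : {rmorphism L -> L}).

Definition skew_mul (p q : {poly L}) : {poly L} :=
  \sum_(i < size p) p`_i *: (map_poly (iter i theta) q * 'X^i).

Fact iter_theta_is_zmod_morphism i : zmod_morphism (iter i theta).
Proof.
elim: i => [//|i IH] x y.
by rewrite !iterS IH rmorphB.
Qed.

Fact iter_theta_is_monoid_morphism i : monoid_morphism (iter i theta).
Proof.
split; first by elim: i => //= i ->; rewrite rmorph1.
by elim: i => [//|i IH] x y; rewrite !iterS IH rmorphM.
Qed.

HB.instance Definition _ i :=
  GRing.isZmodMorphism.Build L L (iter i theta) (iter_theta_is_zmod_morphism i).
HB.instance Definition _ i :=
  GRing.isMonoidMorphism.Build L L (iter i theta)
    (iter_theta_is_monoid_morphism i).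

Lemma skew_mul_widen N (p q : {poly L}) : (size p <= N)%N ->
  skew_mul p q = \sum_(i < N) p`_i *: (map_poly (iter i theta) q * 'X^i).
Proof.
move=> leN; rewrite /skew_mul.
rewrite (big_ord_widen N
  (fun i => p`_i *: (map_poly (iter i theta) q * 'X^i))) //.
rewrite big_mkcond /=; apply: eq_bigr => i _; case: ltnP => // hi.
by rewrite nth_default // scale0r.
Qed.

Fact skew_mulDl : left_distributive skew_mul +%R.
Proof.
move=> p p' q; pose N := maxn (size p) (size p').
rewrite !(@skew_mul_widen N) ?leq_maxl ?leq_maxr ?size_polyD //.
by rewrite -big_split; apply: eq_bigr => i _; rewrite coefD scalerDl.
Qed.

Fact skew_mulDr : right_distributive skew_mul +%R.
Proof.
move=> p q q'; rewrite -big_split; apply: eq_bigr => i _.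
by rewrite rmorphD mulrDl scalerDr.
Qed.

Lemma skew_mulZl a p q : skew_mul (a *: p) q = a *: skew_mul p q.
Proof.
rewrite !(@skew_mul_widen (size p)) ?size_scale_leq // scaler_sumr.
by apply: eq_bigr => i _; rewrite coefZ scalerA.
Qed.

Lemma skew_mulXnl i q : skew_mul 'X^i q = map_poly (iter i theta) q * 'X^i.
Proof.
rewrite (@skew_mul_widen i.+1) ?size_polyXn // big_ord_recr /=.
rewrite coefXn eqxx scale1r big1 ?add0r // => j _.
by rewrite coefXn ltn_eqF ?scale0r.
Qed.

Lemma skew_mul0l q : skew_mul 0 q = 0.
Proof. by rewrite /skew_mul size_poly0 big_ord0. Qed.

Lemma skew_mul0r p : skew_mul p 0 = 0.
Proof. by apply: big1 => i _; rewrite rmorph0 mul0r scaler0. Qed.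

Lemma skew_mul_suml I (r : seq I) (f : I -> {poly L}) q :
  skew_mul (\sum_(i <- r) f i) q = \sum_(i <- r) skew_mul (f i) q.
Proof.
exact: (big_morph (skew_mul^~ q) (fun x y => skew_mulDl x y q) (skew_mul0l q)).
Qed.

Lemma skew_mul_sumr I (r : seq I) (f : I -> {poly L}) p :
  skew_mul p (\sum_(i <- r) f i) = \sum_(i <- r) skew_mul p (f i).
Proof.
exact: (big_morph (skew_mul p) (fun x y => skew_mulDr p x y) (skew_mul0r p)).
Qed.

Lemma poly_sum_coef (p : {poly L}) : p = \sum_(i < size p) p`_i *: 'X^i.
Proof. by rewrite -poly_def coefK. Qed.

Fact skew_mulA : associative skew_mul.
Proof.
move=> p q r; rewrite [p]poly_sum_coef.
rewrite 2!(skew_mul_suml _ _ (skew_mul q r), skew_mul_suml _ _ q).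
rewrite skew_mul_suml; apply: eq_bigr => i _.
rewrite !skew_mulZl; congr (_ *: _).
rewrite [q]poly_sum_coef (skew_mul_suml _ _ r) !skew_mul_sumr skew_mul_suml.
apply: eq_bigr => j _; rewrite skew_mulZl !skew_mulXnl.
rewrite !map_polyZ map_polyXn -!scalerAl -exprD skew_mulZl skew_mulXnl.
rewrite rmorphM /= map_polyXn -mulrA -exprD (addnC j).
congr (_ *: (_ * _)); apply/polyP=> k.
by rewrite !coef_map /= iterD.
Qed.

Fact skew_mul1l : left_id 1 skew_mul.
Proof. by move=> q; rewrite -(expr0 'X) skew_mulXnl mulr1 map_poly_id. Qed.

Fact skew_mul1r : right_id 1 skew_mul.
Proof.
move=> p; rewrite {2}[p]poly_sum_coef /skew_mul; apply: eq_bigr => i _.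
by rewrite rmorph1 mul1r.
Qed.

Local Notation skewpoly := (skewpoly theta).
Local Notation SkewPoly := (@SkewPoly L theta).
Local Notation skew_val := (@skew_val L theta).

HB.instance Definition _ := [isNew for skew_val].
HB.instance Definition _ := [Choice of skewpoly by <:].

Implicit Types (u v w : skewpoly) (a b : L).

Definition skp_zero := SkewPoly 0.
Definition skp_opp u := SkewPoly (- skew_val u).
Definition skp_add u v := SkewPoly (skew_val u + skew_val v).
Definition skp_scale a u := SkewPoly (a *: skew_val u).
Definition skp_one := SkewPoly 1.
Definition skp_mul u v := SkewPoly (skew_mul (skew_val u) (skew_val v)).

Fact skp_addA : associative skp_add.
Proof. by move=> u v w; apply: val_inj; apply: addrA. Qed.
Fact skp_addC : commutative skp_add.
Proof. by move=> u v; apply: val_inj; apply: addrC. Qed.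
Fact skp_add0 : left_id skp_zero skp_add.
Proof. by move=> u; apply: val_inj; apply: add0r. Qed.
Fact skp_addN : left_inverse skp_zero skp_opp skp_add.
Proof. by move=> u; apply: val_inj; apply: addNr. Qed.

HB.instance Definition _ :=
  GRing.isZmodule.Build skewpoly skp_addA skp_addC skp_add0 skp_addN.

Fact skp_mulA : associative skp_mul.
Proof. by move=> u v w; apply: val_inj; apply: skew_mulA. Qed.
Fact skp_mul1l : left_id skp_one skp_mul.
Proof. by move=> u; apply: val_inj; apply: skew_mul1l. Qed.
Fact skp_mul1r : right_id skp_one skp_mul.
Proof. by move=> u; apply: val_inj; apply: skew_mul1r. Qed.
Fact skp_mulDl : left_distributive skp_mul +%R.
Proof. by move=> u v w; apply: val_inj; apply: skew_mulDl. Qed.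
Fact skp_mulDr : right_distributive skp_mul +%R.
Proof. by move=> u v w; apply: val_inj; apply: skew_mulDr. Qed.
Fact skp_one_neq0 : skp_one != 0.
Proof. by apply/eqP => -[] /eqP; rewrite oner_eq0. Qed.

HB.instance Definition _ := GRing.Zmodule_isNzRing.Build skewpoly
  skp_mulA skp_mul1l skp_mul1r skp_mulDl skp_mulDr skp_one_neq0.

Fact skp_scaleA a b u : skp_scale a (skp_scale b u) = skp_scale (a * b) u.
Proof. by apply: val_inj; apply: scalerA. Qed.
Fact skp_scale1 : left_id 1 skp_scale.
Proof. by move=> u; apply: val_inj; apply: scale1r. Qed.
Fact skp_scaleDr : right_distributive skp_scale +%R.
Proof. by move=> a u v; apply: val_inj; apply: scalerDr. Qed.
Fact skp_scaleDl u : {morph skp_scale^~ u : a b / a + b}.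
Proof. by move=> a b; apply: val_inj; apply: scalerDl. Qed.

HB.instance Definition _ := GRing.Zmodule_isLmodule.Build L skewpoly
  skp_scaleA skp_scale1 skp_scaleDr skp_scaleDl.

Fact skp_scaleAl a u v : a *: (u * v) = a *: u * v.
Proof. by apply: val_inj; rewrite /= skew_mulZl. Qed.

HB.instance Definition _ :=
  GRing.Lmodule_isLalgebra.Build L skewpoly skp_scaleAl.

Fact skew_val_is_zmod_morphism : zmod_morphism skew_val.
Proof. by []. Qed.

HB.instance Definition _ := GRing.isZmodMorphism.Build skewpoly {poly L}
  skew_val skew_val_is_zmod_morphism.

Definition skewX : skewpoly := SkewPoly 'X.

Lemma skewXn i : skew_val (skewX ^+ i) = 'X^i.
Proof.
elim: i => // i IH; rewrite exprS /= IH.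
by rewrite -{1}(expr1 'X) skew_mulXnl map_polyXn -exprD addn1.
Qed.

Lemma skewX_commute a : skewX * a%:A = (theta a)%:A * skewX.
Proof.
apply: val_inj => /=; rewrite skew_mulZl skew_mul1l -{1}(expr1 'X).
by rewrite skew_mulXnl map_polyZ rmorph1 -scalerAl mul1r.
Qed.

End SkewPoly.

(* F(X^n) is central in L[X; sigma] for n = \dim {:L}, so that its left multiples
   form a two-sided ideal. *)
Section SkewQuotient.

Variables (K : finFieldType) (L : splittingFieldType K) (sigma : gal_of {:L}).

Local Notation n := (\dim {:L}).

Local Notation R := (skewpoly (gal_repr sigma)).
Local Notation X := (skewX (gal_repr sigma)).

Definition eval_Xn (F : {poly K}) : R :=
  \sum_(i < size F) (F`_i)%:A%:A * X ^+ (n * i).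

Definition ideal_Xn (F : {poly K}) : {pred R} :=
  fun f => `[< exists g, f = g * eval_Xn F >].

Lemma ideal_XnP (F : {poly K}) (f : R) :
  reflect (exists g, f = g * eval_Xn F) (f \in ideal_Xn F).
Proof. exact: asboolP. Qed.

Fact ideal_Xn_zmod (F : {poly K}) : zmod_closed (ideal_Xn F).
Proof.
split=> [|f g /ideal_XnP[f' ->] /ideal_XnP[g' ->]]; apply/ideal_XnP.
  by exists 0; rewrite mul0r.
by exists (f' - g'); rewrite mulrBl.
Qed.

HB.instance Definition _ (F : {poly K}) :=
  GRing.isZmodClosed.Build R (ideal_Xn F)
    (ideal_Xn_zmod F).

Fact ideal_Xn_left (F : {poly K}) (a f : R) :
  f \in ideal_Xn F -> a * f \in ideal_Xn F.
Proof.
by move=> /ideal_XnP[g ->]; apply/ideal_XnP; exists (a * g); rewrite mulrA.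
Qed.

Lemma iter_sigma i (x : L) : iter i sigma x = (sigma ^+ i)%g x.
Proof.
elim: i x => [|i IH] x; first by rewrite expg0 gal_id.
by rewrite expgSr galM ?memvf // -IH.
Qed.

Lemma iter_sigma_dim i (x : L) : iter (n * i) sigma x = x.
Proof.
rewrite iter_sigma expgM.
have /galois_dim : galois 1 {:L} by apply: finField_galois; apply: sub1v.
rewrite dimv1 divn1 => ->.
have sG : sigma \in 'Gal({:L} / 1)%g by rewrite gal_kHom ?sub1v // k1AHom.
by rewrite (expg_cardG sG) expg1n gal_id.
Qed.

Lemma eval_Xn_central (F : {poly K}) (f : R) :
  eval_Xn F * f = f * eval_Xn F.
Proof.
have scalC c (g : R) :
    c%:A%:A * g = g * c%:A%:A :> R.
  apply: val_inj; rewrite /= skew_mulZl skew_mul1l.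
  rewrite [skew_val g]poly_sum_coef skew_mul_suml scaler_sumr.
  apply: eq_bigr => i _; rewrite skew_mulZl skew_mulXnl map_polyZ rmorph1 /=.
  rewrite iter_sigma -in_algE rmorph_alg -scalerAl mul1r !scalerA mulrC //.
have XnC i (g : R) :
    X ^+ (n * i) * g = g * X ^+ (n * i).
  apply: val_inj; rewrite /= skewXn skew_mulXnl map_poly_id; last first.
    by move=> x _; exact: iter_sigma_dim.
  rewrite {1}[skew_val g]poly_sum_coef mulr_suml.
  by apply: eq_bigr => j _; rewrite map_polyXn -scalerAl -!exprD addnC.
rewrite mulr_suml mulr_sumr; apply: eq_bigr => i _.
by rewrite -mulrA XnC !mulrA scalC.
Qed.

Fact ideal_Xn_right (F : {poly K}) (a f : R) :
  f \in ideal_Xn F -> f * a \in ideal_Xn F.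
Proof.
move=> /ideal_XnP[g ->]; apply/ideal_XnP; exists (g * a).
by rewrite -!mulrA eval_Xn_central.
Qed.

Definition skew_quot (F : {poly K}) : Type :=
  ts_quot (@ideal_Xn_left F) (@ideal_Xn_right F).

HB.instance Definition _ (F : {poly K}) := GRing.PzRing.on (skew_quot F).

Definition skew_pi (F : {poly K}) : {rmorphism R -> skew_quot F} :=
  ts_pi (@ideal_Xn_left F) (@ideal_Xn_right F).

Definition skew_code (s k : nat) (F : {poly K}) : set (skew_quot F) :=
  [set skew_pi F (\sum_(i < s * k) (alpha i)%:A * X ^+ i)
     | alpha in [set: 'I_(s * k) -> L]]%classic.

End SkewQuotient.

Arguments skew_code {K L} sigma s k F.

Section CodeEquivalence.

Variables (K : finFieldType) (L : splittingFieldType K) (sigma : gal_of {:L}).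
Variables (E : fieldExtType K) (n s k : nat).

Definition mx_transform (rho : E -> E) (U V : 'M[E]_n) (D : set 'M[E]_n) :
  set 'M[E]_n := [set U *m map_mx rho A *m V | A in D]%classic.

Definition mx_linear_equiv (D D' : set 'M[E]_n) : Prop :=
  exists U V : 'M[E]_n,
    [/\ U \in unitmx, V \in unitmx & D' = mx_transform id U V D].

Definition mx_Gamma_equiv (D D' : set 'M[E]_n) : Prop :=
  exists (U V : 'M[E]_n) (rho : {rmorphism E -> E}),
    [/\ U \in unitmx, V \in unitmx, bijective rho &
        D' = mx_transform rho U V D].

(* Isomorphism of K-algebras; the library only sees 'M[E]_n as an E-module, hence
   the explicit condition on constants. *)
Definition is_alg_iso (F : {poly K})
    (phi : {rmorphism skew_quot sigma F -> 'M[E]_n}) : Prop :=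
  bijective phi /\ forall c : K, phi (skew_pi sigma F c%:A%:A) = (c%:A)%:M.

Definition code_equiv (mx_equiv : set 'M[E]_n -> set 'M[E]_n -> Prop)
    (F G : {poly K}) : Prop :=
  exists (phi : {rmorphism skew_quot sigma F -> 'M[E]_n})
         (psi : {rmorphism skew_quot sigma G -> 'M[E]_n}),
    [/\ is_alg_iso phi, is_alg_iso psi &
        mx_equiv (phi @` skew_code sigma s k F)%classic
                 (psi @` skew_code sigma s k G)%classic].

Definition code_linear_equiv := code_equiv mx_linear_equiv.
Definition code_Gamma_equiv := code_equiv mx_Gamma_equiv.

End CodeEquivalence.

Section IrreduciblePolys.

Variables (K : finFieldType) (s : nat).

Definition irr_poly_pred (F : {poly K}) : bool :=
  [&& F \is monic, size F == s.+1 & irreducibleb F].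

Record irr_poly : predArgType :=
  IrrPoly { irr_val :> {poly K}; irr_valP : irr_poly_pred irr_val }.

HB.instance Definition _ := [isSub for irr_val].
HB.instance Definition _ := [Choice of irr_poly by <:].

Definition irr_npoly (F : irr_poly) : {poly_s.+1 K} :=
  insubd (0 : {poly_s.+1 K}) (irr_val F).
Definition npoly_irr (F : {poly_s.+1 K}) : option irr_poly := insub (val F).

Fact irr_npolyK : pcancel irr_npoly npoly_irr.
Proof.
move=> F; rewrite /npoly_irr val_insubd.
have /and3P[_ /eqP sF _] := irr_valP F.
by rewrite qualifE /= sF leqnn valK.
Qed.

HB.instance Definition _ := Countable.copy irr_poly (pcan_type irr_npolyK).
HB.instance Definition _ : isFinite irr_poly := PCanIsFinite irr_npolyK.

End IrreduciblePolys.

(* Gal(F_q / F_p) is realised as the group of all ring automorphisms of K: a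
   ring automorphism fixes the prime field. *)
Section FieldAutomorphisms.

Variable K : finFieldType.

Definition field_auts : {set {perm K}} :=
  [set t : {perm K} | [&& t 1 == 1,
     [forall x, forall y, t (x + y) == t x + t y] &
     [forall x, forall y, t (x * y) == t x * t y]]].

Lemma field_autsP (t : {perm K}) :
  reflect [/\ t 1 = 1, {morph t : x y / x + y} & {morph t : x y / x * y}]
          (t \in field_auts).
Proof.
rewrite inE; apply: (iffP and3P) => -[t1 tD tM].
  split=> [|x y|x y]; first exact: eqP.
    by move/forallP: tD => /(_ x)/forallP/(_ y)/eqP.
  by move/forallP: tM => /(_ x)/forallP/(_ y)/eqP.
split; first exact/eqP.
  by apply/'forall_forallP => x y; apply/eqP.
by apply/'forall_forallP => x y; apply/eqP.
Qed.

Fact field_auts_group_set : group_set field_auts.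
Proof.
apply/group_setP; split.
  by apply/field_autsP; split=> [|x y|x y]; rewrite !perm1.
move=> t u /field_autsP[t1 tD tM] /field_autsP[u1 uD uM]; apply/field_autsP.
by split=> [|x y|x y]; rewrite !permM ?t1 // ?tD ?tM ?uD ?uM.
Qed.

Canonical field_auts_group := Group field_auts_group_set.

Definition aut_fun (t : [subg field_auts_group]) : K -> K := sgval t.

Lemma aut_funP (t : [subg field_auts_group]) :
  [/\ aut_fun t 1 = 1, {morph aut_fun t : x y / x + y}
    & {morph aut_fun t : x y / x * y}].
Proof. exact/field_autsP/subgP. Qed.

Fact aut_fun_is_zmod_morphism t : zmod_morphism (aut_fun t).
Proof.
have [_ tD _] := aut_funP t.
move=> x y; apply: (addIr (aut_fun t y)).
by rewrite -tD !subrK.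
Qed.

Fact aut_fun_is_monoid_morphism t : monoid_morphism (aut_fun t).
Proof. by have [t1 _ tM] := aut_funP t. Qed.

HB.instance Definition _ t :=
  GRing.isZmodMorphism.Build K K (aut_fun t) (aut_fun_is_zmod_morphism t).
HB.instance Definition _ t :=
  GRing.isMonoidMorphism.Build K K (aut_fun t) (aut_fun_is_monoid_morphism t).

Lemma aut_fun1 x : aut_fun 1%g x = x.
Proof. by rewrite /aut_fun /= perm1. Qed.

Lemma aut_funM t u x : aut_fun (t * u)%g x = aut_fun u (aut_fun t x).
Proof. by rewrite /aut_fun /= permM. Qed.

Fact aut_unit_subproof (t : [subg field_auts_group]) (a : {unit K}) :
  aut_fun t (val a) \is a GRing.unit.
Proof. by rewrite rmorph_unit ?(valP a). Qed.

Definition aut_unit (t : [subg field_auts_group]) (a : {unit K}) : {unit K} :=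
  FinRing.Unit (aut_unit_subproof t a).

Lemma aut_unit1 a : aut_unit 1%g a = a.
Proof. by apply: val_inj; rewrite /= aut_fun1. Qed.

Lemma aut_unitM t a b : aut_unit t (a * b)%g = (aut_unit t a * aut_unit t b)%g.
Proof. by apply: val_inj; rewrite /= rmorphM. Qed.

Lemma aut_unitV t a : aut_unit t a^-1%g = (aut_unit t a)^-1%g.
Proof. by apply: val_inj; rewrite /= fmorphV. Qed.

Lemma aut_unit_mul t u a : aut_unit (t * u)%g a = aut_unit u (aut_unit t a).
Proof. by apply: val_inj; rewrite /= aut_funM. Qed.

End FieldAutomorphisms.

Section TwistGroup.

Variable K : finFieldType.

(* F_q^* semidirect (<iota> x Gal(F_q / F_p)); an element stands for the product
   of its components in the order automorphism, iota, scaling, acting from the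
   right (as all actions of the library do) in that order. *)
Record twist : predArgType := Twist {
  tw_scal : {unit K};
  tw_inv : bool;
  tw_aut : [subg field_auts_group K]
}.

Definition twist_prod (g : twist) := (tw_scal g, tw_inv g, tw_aut g).
Definition prod_twist x := Twist x.1.1 x.1.2 x.2.
Fact twist_prodK : cancel twist_prod prod_twist. Proof. by case. Qed.

HB.instance Definition _ := Countable.copy twist (can_type twist_prodK).
HB.instance Definition _ : isFinite twist := CanIsFinite twist_prodK.

Definition unit_inv_if (e : bool) (a : {unit K}) : {unit K} :=
  (if e then a^-1 else a)%g.

Definition tw_mul (g h : twist) : twist :=
  Twist (unit_inv_if (tw_inv h) (aut_unit (tw_aut h) (tw_scal g)) * tw_scal h)%g
        (tw_inv g (+) tw_inv h) (tw_aut g * tw_aut h)%g.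

Definition tw_one : twist := Twist 1%g false 1%g.

Definition tw_invg (g : twist) : twist :=
  Twist (unit_inv_if (~~ tw_inv g) (aut_unit (tw_aut g)^-1%g (tw_scal g)))
        (tw_inv g) (tw_aut g)^-1%g.

Lemma unit_mulgC : commutative (@mulg {unit K}).
Proof. by move=> a b; apply: val_inj; apply: mulrC. Qed.

Lemma unit_inv_ifM e a b :
  unit_inv_if e (a * b)%g = (unit_inv_if e a * unit_inv_if e b)%g.
Proof. by case: e; rewrite //= invMg unit_mulgC. Qed.

Lemma aut_unit_inv_if t e a :
  aut_unit t (unit_inv_if e a) = unit_inv_if e (aut_unit t a).
Proof. by case: e; rewrite //= aut_unitV. Qed.

Lemma unit_inv_if_add e f a :
  unit_inv_if (e (+) f) a = unit_inv_if f (unit_inv_if e a).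
Proof. by case: e f => [] [] //=; rewrite invgK. Qed.

Fact tw_mulA : associative tw_mul.
Proof.
move=> g h l; rewrite /tw_mul /= addbA mulgA aut_unitM unit_inv_ifM.
by rewrite aut_unit_mul aut_unit_inv_if unit_inv_if_add !mulgA.
Qed.

Fact tw_mul1 : left_id tw_one tw_mul.
Proof.
case=> a e t; rewrite /tw_mul /= !mul1g; congr Twist.
have -> : aut_unit t 1%g = 1%g by apply: val_inj; rewrite /= rmorph1.
by case: e; rewrite /= ?invg1 mul1g.
Qed.

Fact tw_mulV : left_inverse tw_one tw_invg tw_mul.
Proof.
case=> a e t; rewrite /tw_mul /tw_one /= addbb mulVg; congr Twist.
rewrite aut_unit_inv_if -aut_unit_mul mulVg aut_unit1.
by rewrite -unit_inv_if_add; case: e; rewrite /= mulVg.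
Qed.

HB.instance Definition _ := Finite_isGroup.Build twist tw_mulA tw_mul1 tw_mulV.

Variable n : nat.

Definition calGhat : {set twist} := [set g : twist | tw_inv g ==> (n == 2%N)].
Definition calG : {set twist} :=
  [set g : twist | (tw_inv g ==> (n == 2%N)) && (tw_aut g == 1%g)].

Fact calGhat_group_set : group_set calGhat.
Proof.
apply/group_setP; split=> [|g h]; rewrite ?inE //= => gi hi.
by move: gi hi; case: (tw_inv g) (tw_inv h) => [] [].
Qed.
Canonical calGhat_group := Group calGhat_group_set.

Fact calG_group_set : group_set calG.
Proof.
apply/group_setP; split=> [|g h]; rewrite !inE //= => /andP[gi /eqP ->].
move=> /andP[hi /eqP ->]; rewrite mulg1 eqxx andbT.
by move: gi hi; case: (tw_inv g) (tw_inv h) => [] [].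
Qed.
Canonical calG_group := Group calG_group_set.

End TwistGroup.

Section PolyAction.

Variables (K : finFieldType) (s : nat).
Implicit Types (F : {poly K}) (a : {unit K}).

Definition scale_poly a F : {poly K} :=
  val a ^+ s *: (F \Po ((val a)^-1 *: 'X)).

(* F(0)^-1 Y^s F(1/Y), for F of degree at most s *)
Definition recip_poly F : {poly K} := F.[0]^-1 *: \poly_(i < s.+1) F`_(s - i).

Definition twist_poly F (g : twist K) : {poly K} :=
  scale_poly (tw_scal g)
    (let Ft := map_poly (aut_fun (tw_aut g)) F in
     if tw_inv g then recip_poly Ft else Ft).

Lemma coef_scale_poly a F i :
  (scale_poly a F)`_i = val a ^+ s * (val a) ^- i * F`_i.
Proof.
rewrite coefZ -mulrA; congr (_ * _); rewrite [in LHS](poly_sum_coef F).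
rewrite raddf_sum coef_sum /=.
under eq_bigr => j _ do
  rewrite comp_polyZ comp_Xn_poly exprZn !coefZ coefXn exprVn.
case: (ltnP i (size F)) => hi.
  rewrite (bigD1 (Ordinal hi)) //= eqxx mulr1 mulrC big1 ?addr0 // => j.
  by rewrite -val_eqE /= eq_sym => /negPf->; rewrite !mulr0.
rewrite (nth_default _ hi) mulr0 big1 // => j _.
by rewrite gtn_eqF ?mulr0 // (leq_trans (ltn_ord j)).
Qed.

Lemma coef_recip_poly F i :
  (recip_poly F)`_i = if (i <= s)%N then (F`_0)^-1 * F`_(s - i) else 0.
Proof.
rewrite coefZ coef_poly ltnS horner_coef0.
by case: ifP => //; rewrite mulr0.
Qed.

Lemma unit_val_neq0 a : val a != 0.
Proof. by rewrite -unitfE (valP a). Qed.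

Lemma map_scale_poly t a F : map_poly (aut_fun t) (scale_poly a F) =
  scale_poly (aut_unit t a) (map_poly (aut_fun t) F).
Proof.
apply/polyP=> i; rewrite !(coef_map, coef_scale_poly) /=.
by rewrite !rmorphM fmorphV !rmorphXn.
Qed.

Lemma recip_scale_poly a F :
  recip_poly (scale_poly a F) = scale_poly a^-1%g (recip_poly F).
Proof.
apply/polyP=> i; rewrite !(coef_recip_poly, coef_scale_poly) /=.
case: leqP => his; rewrite ?mulr0 // expr0 invr1 mulr1.
rewrite expfB_cond ?(negPf (unit_val_neq0 a)) ?add0n // invf_div !invfM.
rewrite -!exprVn !invrK mulrCA.
have ane : val a ^+ s != 0 by rewrite expf_neq0 ?unit_val_neq0.
rewrite exprVn; move: (val a ^+ s) ane (val a ^+ i) ((F`_0)^-1) => x x0 y z.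
by rewrite !mulrA; congr (_ * _); rewrite -!mulrA; field.
Qed.

Lemma scale_scale_poly a b F :
  scale_poly a (scale_poly b F) = scale_poly (b * a)%g F.
Proof.
apply/polyP=> i; rewrite !coef_scale_poly /= !exprMn invfM.
move: (val a ^+ s) (val b ^+ s) (val a ^- i) (val b ^- i) (F`_i) => x y z t f.
by ring.
Qed.

Lemma map_recip_poly t F : map_poly (aut_fun t) (recip_poly F) =
  recip_poly (map_poly (aut_fun t) F).
Proof.
apply/polyP=> i; rewrite !(coef_map, coef_recip_poly) /=.
by case: ifP => _; rewrite ?rmorph0 // rmorphM fmorphV.
Qed.

Lemma recip_recip_poly F : F \is monic -> size F = s.+1 -> F`_0 != 0 ->
  recip_poly (recip_poly F) = F.
Proof.
move=> /monicP mF sF F0; apply/polyP=> i.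
rewrite !coef_recip_poly leq0n subn0 leq_subr.
have -> : F`_s = 1 by rewrite -mF lead_coefE sF.
case: leqP => his; last by rewrite nth_default ?sF.
by rewrite subKn // mulr1 invrK mulVKf.
Qed.

Lemma irr_polyI F : (1 < size F)%N ->
    (forall A B, F = A * B -> size A = 1%N \/ size B = 1%N) ->
  irreducible_poly F.
Proof.
move=> sF irrF; split=> // q sq /dvdpP[A eF].
have [sA|/eqP] := irrF _ _ eF; last by rewrite (negPf sq).
have /eqP/size_poly1P[c c0 eA] := sA.
by rewrite eF eA mul_polyC eqp_sym eqp_scale.
Qed.

Lemma irr_polyE F A B : irreducible_poly F -> F = A * B ->
  size A = 1%N \/ size B = 1%N.
Proof.
move=> irrF eF; have [sA|sA] := eqVneq (size A) 1%N; [by left | right].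
have dA : A %| F by rewrite eF dvdp_mulr.
have /eqp_size sAF := irrF.2 A sA dA.
have F0 := irredp_neq0 irrF; move: (F0); rewrite eF mulf_eq0 negb_or.
case/andP=> A0 B0; move: sAF; rewrite eF size_mul //.
have sA0 : (0 < size A)%N by rewrite size_poly_gt0.

by clear sA; move: sA0; move: (size A) (size B) => x y; lia.

Qed.

Lemma scale_poly_irr a F :
  irr_poly_pred s F -> irr_poly_pred s (scale_poly a F).
Proof.
have sX (c : K) : c != 0 -> size (c *: 'X : {poly K}) = 2%N.
  by move=> c0; rewrite size_scale // size_polyX.
have a0 := unit_val_neq0 a; have as0 : val a ^+ s != 0 by rewrite expf_neq0.
have ai0 : (val a)^-1 != 0 by rewrite invr_eq0.
move=> /and3P[/monicP mF /eqP sF /irreducibleP irrF].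
have sS : size (scale_poly a F) = s.+1.
  by rewrite size_scale // size_comp_poly2 ?sX.
apply/and3P; split; [|exact/eqP|].
  apply/monicP; rewrite lead_coefE sS coef_scale_poly /= divff // mul1r.
  by rewrite -mF lead_coefE sF.
apply/irreducibleP/irr_polyI; first by rewrite sS -sF; case: irrF.
move=> A B eAB.
have eF : F =
    ((val a ^+ s)^-1 *: (A \Po (val a *: 'X))) * (B \Po (val a *: 'X)).
  rewrite -scalerAl -comp_polyM -eAB comp_polyZ scalerA mulVf // scale1r.
  rewrite -comp_polyA comp_polyZ comp_polyX scalerA mulVf // scale1r.
  by rewrite comp_polyXr.
have := irr_polyE irrF eF.
by rewrite size_scale ?invr_eq0 // !size_comp_poly2 ?sX.
Qed.

Lemma map_poly_irr t F :
  irr_poly_pred s F -> irr_poly_pred s (map_poly (aut_fun t) F).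
Proof.
move=> /and3P[mF /eqP sF /irreducibleP irrF].
have sM : size (map_poly (aut_fun t) F) = s.+1 by rewrite size_map_poly.
apply/and3P; split; [by rewrite map_monic|exact/eqP|].
apply/irreducibleP/irr_polyI; first by rewrite sM -sF; case: irrF.
move=> A B eAB; pose u := t^-1%g.
have eF : F = map_poly (aut_fun u) A * map_poly (aut_fun u) B.
  rewrite -rmorphM -eAB; apply/polyP=> i.
  by rewrite !coef_map /= -aut_funM mulgV aut_fun1.
by have := irr_polyE irrF eF; rewrite !size_map_poly.
Qed.

Lemma irr_coef0 F : (1 < s)%N -> irr_poly_pred s F -> F`_0 != 0.
Proof.
move=> s1 /and3P[_ /eqP sF /irreducibleP irrF]; apply/eqP => F0.
have /factor_theorem[q eF] : root F 0 by rewrite /root horner_coef0 F0.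
have F_neq0 := irredp_neq0 irrF.
case: (irr_polyE irrF eF) => [sq|]; last by rewrite size_XsubC.
move: sF F_neq0; rewrite eF mulf_eq0 polyXsubC_eq0 orbF => + q0.
rewrite size_mul ?polyXsubC_eq0 // sq size_XsubC; lia.
Qed.

(* Y^m A(1/Y), for A of degree at most m *)
Definition rev_poly m (A : {poly K}) : {poly K} := \poly_(i < m.+1) A`_(m - i).

Lemma rev_poly_sum m N (f : 'I_N -> {poly K}) :
  rev_poly m (\sum_i f i) = \sum_i rev_poly m (f i).
Proof.
apply/polyP=> i; rewrite coef_poly !coef_sum.
under [in RHS]eq_bigr => j _ do rewrite coef_poly.
by case: ifP => // _; rewrite big1.
Qed.

Lemma rev_polyXn m (c : K) j : (j <= m)%N ->
  rev_poly m (c *: 'X^j) = c *: 'X^(m - j).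
Proof.
move=> jm; apply/polyP=> i; rewrite coef_poly !coefZ !coefXn.
case: ltnP => im; first by congr (_ * (nat_of_bool _)%:R); lia.
by have -> : (i == m - j)%N = false; [lia | rewrite mulr0].
Qed.

Lemma poly_pad m (A : {poly K}) : (size A <= m.+1)%N ->
  A = \sum_(i < m.+1) A`_i *: 'X^i.
Proof.
move=> sA; rewrite -poly_def; apply/polyP=> i; rewrite coef_poly.
by case: ltnP => // h; rewrite nth_default // (leq_trans sA).
Qed.

Lemma rev_polyM m l (A B : {poly K}) :
  (size A <= m.+1)%N -> (size B <= l.+1)%N ->
  rev_poly (m + l) (A * B) = rev_poly m A * rev_poly l B.
Proof.
move=> /poly_pad -> /poly_pad ->.
rewrite mulr_suml !rev_poly_sum mulr_suml; apply: eq_bigr => i _.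
rewrite mulr_sumr rev_poly_sum mulr_sumr; apply: eq_bigr => j _.
have hi : (i <= m)%N by rewrite -ltnS.
have hj : (j <= l)%N by rewrite -ltnS.
rewrite -!scalerAl -!scalerAr -exprD scalerA !rev_polyXn ?leq_add //.
rewrite -!scalerAl -!scalerAr -exprD scalerA.
by congr (_ *: 'X^_); lia.
Qed.

Lemma recip_poly_irr F : (1 < s)%N ->
  irr_poly_pred s F -> irr_poly_pred s (recip_poly F).
Proof.
move=> s1 pF; have F0 := irr_coef0 s1 pF.
move: (pF) => /and3P[mF /eqP sF /irreducibleP irrF].
have Fs : F`_s = 1 by rewrite -(monicP mF) lead_coefE sF.
have cs : (recip_poly F)`_s = 1.
  by rewrite coef_recip_poly leqnn subnn mulVf.
have sR : size (recip_poly F) = s.+1.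
  apply/eqP; rewrite eqn_leq; apply/andP; split.
    by rewrite (leq_trans (size_scale_leq _ _)) ?size_poly.
  rewrite ltnNge; apply/negP => h; move: cs.
  by rewrite nth_default // => /esym/eqP; rewrite oner_eq0.
apply/and3P; split; [by apply/monicP; rewrite lead_coefE sR | exact/eqP|].
apply/irreducibleP/irr_polyI; first by rewrite sR; lia.
move=> A B eAB.
have : recip_poly F != 0 by rewrite -size_poly_eq0 sR.
rewrite eAB mulf_eq0 negb_or => /andP[A0 B0].
have sA0 : (0 < size A)%N by rewrite size_poly_gt0.
have sB0 : (0 < size B)%N by rewrite size_poly_gt0.
pose m := (size A).-1; pose l := (size B).-1.
have sml : s = (m + l)%N.
  move: sR; rewrite eAB size_mul // -(prednK sA0) -(prednK sB0) -/m -/l.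
  by rewrite addSn addnS => -[].
have eF : F = F`_0 *: rev_poly m A * rev_poly l B.
  rewrite -scalerAl -rev_polyM ?/m ?/l ?prednK // -/m -/l -sml -eAB.
  apply/polyP=> i; rewrite coefZ coef_poly ltnS.
  case: leqP => his; last by rewrite mulr0 nth_default ?sF.
  by rewrite coef_recip_poly leq_subr subKn // mulVKf.
have FN := irredp_neq0 irrF; move: (FN); rewrite {1}eF mulf_eq0 negb_or.
case/andP=> rA0 rB0.
have eS : size F = (size (F`_0 *: rev_poly m A) + size (rev_poly l B)).-1.
  by rewrite {1}eF size_mul.
have sA : (size (F`_0 *: rev_poly m A) <= m.+1)%N.
  by rewrite (leq_trans (size_scale_leq _ _)) ?size_poly.
have sB : (size (rev_poly l B) <= l.+1)%N by rewrite size_poly.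
have sAB : s.+1 = (size (F`_0 *: rev_poly m A) + size (rev_poly l B)).-1.
  by rewrite -eS sF.
case: (irr_polyE irrF eF) => e; [left | right].
  by rewrite -(prednK sA0) -/m; move: sAB sB; rewrite e; clear -sml; lia.
by rewrite -(prednK sB0) -/l; move: sAB sA; rewrite e; clear -sml; lia.
Qed.

Lemma twist_poly_irr F g : (1 < s)%N ->
  irr_poly_pred s F -> irr_poly_pred s (twist_poly F g).
Proof.
move=> s1 pF; apply: scale_poly_irr => /=; have := map_poly_irr (tw_aut g) pF.
by case: ifP => // _; apply: recip_poly_irr.
Qed.

Lemma twist_poly1 F : twist_poly F 1%g = F.
Proof.
apply/polyP=> i; rewrite /twist_poly coef_scale_poly coef_map /=.
by rewrite !expr1n invr1 !mul1r aut_fun1.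
Qed.

Lemma twist_polyM F g h : (1 < s)%N -> irr_poly_pred s F ->
  twist_poly F (g * h)%g = twist_poly (twist_poly F g) h.
Proof.
move=> s1 pF; rewrite /twist_poly /=.
have -> : map_poly (aut_fun (tw_aut g * tw_aut h)%g) F =
    map_poly (aut_fun (tw_aut h)) (map_poly (aut_fun (tw_aut g)) F).
  by apply/polyP=> i; rewrite !coef_map /= aut_funM.
rewrite map_scale_poly; set Ft := map_poly (aut_fun (tw_aut g)) F.
have pG : irr_poly_pred s (map_poly (aut_fun (tw_aut h)) Ft).
  by do 2!apply: map_poly_irr.
have rK := recip_recip_poly (proj1 (andP pG)).
case: (tw_inv g) (tw_inv h) => [] [] /=;
  rewrite ?recip_scale_poly scale_scale_poly // ?map_recip_poly //.
by rewrite rK ?(irr_coef0 s1 pG) //; case/and3P: pG => _ /eqP.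
Qed.

Hypothesis s_gt1 : (1 < s)%N.

Definition irr_act (F : irr_poly K s) (g : twist K) : irr_poly K s :=
  IrrPoly (twist_poly_irr g s_gt1 (irr_valP F)).

Fact irr_act1 : irr_act^~ 1%g =1 id.
Proof. by move=> x; apply: val_inj; apply: twist_poly1. Qed.

Fact irr_actM (x : irr_poly K s) : act_morph irr_act x.
Proof.
by move=> g h; apply: val_inj; apply: twist_polyM s_gt1 (irr_valP x).
Qed.

Canonical irr_action := TotalAction irr_act1 irr_actM.

Definition num_orbits (G : {set twist K}) : nat :=
  #|orbit irr_action G @: [set: irr_poly K s]|.

Definition num_classes (R : irr_poly K s -> irr_poly K s -> Prop) : nat :=
  #|equivalence_partition (fun x y => `[< R x y >]) [set: irr_poly K s]|.

End PolyAction.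

(* Main.v *)
(* The code S_k(F) consists of the classes of skew polynomials of degree < sk in
   R_F = R/RF(X^n).  Transporting along matrix isomorphisms, S_k(F) and S_k(G) are
   Gamma-equivalent iff w theta(S_k(F)) = S_k(G) for a ring isomorphism
   theta : R_F -> R_G and a unit w; the equivalence is linear iff theta may be
   taken F_q-linear.

   Both idealizers of S_k(F) are the field L of constants, by comparing degrees,
   so theta and conjugation by w preserve L.  Hence theta and w are homogeneous
   for the Z/n-grading of R_F by powers of X, and u = theta(X) has degree 1.
   Moreover y u lies in S_k(G) for all homogeneous y in S_k(G), except those in
   one residue class mod n.  Let D be the degree of the reduced representative of
   u.  If 1 < D < sn - 1, there are two consecutive exponents v < sk with
   sk <= v + D < sn, and one of X^v u, X^(v+1) u contradicts this.  Thus
   u = a X with a in L, or else n = 2 and D = 2s - 1; in the latter case the same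
   analysis of X u and of u^-1 leaves only u = a X^-1.  Then X^n is sent to N(a) X^n
   or N(a) X^-n, and F(X^n) = 0 expresses G as a twist of F.  Conversely, all norms
   in F_q^* occur, so every twist is realised by such a theta.

   For R_F = M_n(F_(q^s)) it is enough to find a module of dimension n over
   F_(q^s), since a ring morphism out of R_F is injective and the cardinals agree.
   With d = gcd(n, s) and M of degree n/d over F_(q^s), the module is M^d with X
   acting as a twisted cyclic shift whose weight has norm a prescribed root of F. *)
Require Import Defs.
From HB Require Import structures.
From mathcomp Require Import all_boot all_order all_algebra all_fingroup.
From mathcomp Require Import all_solvable all_field.
From mathcomp Require Import boolp classical_sets zify.

Set Implicit Arguments.
Unset Strict Implicit.
Unset Printing Implicit Defensive.

Import GRing.Theory.
Local Open Scope ring_scope.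

(** * Finite fields *)
Lemma prod_cycle (gT : finGroupType) (R : comNzRingType) (x : gT) (f : gT -> R) :
  \prod_(y in <[x]>%g) f y = \prod_(i < #[x]%g) f (x ^+ i)%g.
Proof.
have -> : <[x]>%g = [set (x ^+ val i)%g | i : 'I_#[x]%g].
  apply/setP => y; apply/idP/imsetP => [/cyclePmin[i lti ->]|[i _ ->]].
    by exists (Ordinal lti).
  exact: mem_cycle.
rewrite big_imset //= => i j _ _ /eqP.
by rewrite eq_expg_mod_order !modn_small // => /eqP/val_inj.
Qed.

Lemma finField_pow_gen (F : finFieldType) :
  exists2 w : F, (forall x : F, x != 0 -> exists i, x = w ^+ i) &
  forall i, w ^+ i = 1 -> (#|F|.-1 %| i)%N.
Proof.
have /cyclicP[w ew] := field_unit_group_cyclic [set: {unit F}]%G.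
exists (val w) => [x x0|i].
  have : finField_unit x0 \in <[w]>%g by rewrite -ew inE.
  case/cycleP=> i ei; exists i.
  by rewrite -FinRing.val_unitX -ei.
rewrite -FinRing.val_unitX -[1]FinRing.val_unit1 => /val_inj/eqP.
by rewrite -order_dvdn orderE -ew card_finField_unit.
Qed.

Section FiniteExtension.

Variables (K : finFieldType) (L : splittingFieldType K) (sigma : gal_of {:L}).
Hypothesis sigma_gen : generator 'Gal({:L} / 1)%g sigma.

Local Notation n := (\dim {:L}).

(** Such a [z] is K-linear, hence induced by an element of the Galois group of the normal extension
    L, and [sigma] generates that group. *)
Lemma rmorph_gal (z : {rmorphism L -> L}) :
  (forall c : K, z c%:A = c%:A) -> exists i, forall x, z x = iter i sigma x.
Proof.
move=> zK.
have zZ : scalable z by move=> c x; rewrite -mulr_algl rmorphM /= zK mulr_algl.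
pose zl : {linear L -> L} :=
  HB.pack (z : L -> L) (GRing.isZmodMorphism.Build L L z (rmorphB z))
    (GRing.isScalable.Build K L L *:%R z zZ).
have kz : kHom 1 {:L} (linfun zl).
  apply/kHomP_tmp; split=> [x /vlineP[c ->]|x y _ _]; rewrite !lfunE /=.
    exact: zK.
  exact: rmorphM.
have sb : (1 <= {:L} <= {:L})%VS by rewrite sub1v subvv.
have nL : normalField 1 {:L}.
  by case/and3P: (@finField_galois K L 1%AS {:L}%AS (sub1v _)).
have [x xG ex] := kHom_to_gal sb nL kz.
move: xG; rewrite (eqP sigma_gen) => /cycleP[i ei]; exists i => y.
by rewrite iter_sigma -ei -ex ?memvf // lfunE.
Qed.

Lemma sigma_fixed (x : L) : sigma x = x -> exists c : K, x = c%:A.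
Proof.
move=> sx; suff : x \in 1%VS by move/vlineP.
have g1 : galois 1 {:L} := @finField_galois K L 1%AS {:L}%AS (sub1v _).
rewrite -(galois_fixedField g1); apply/fixedFieldP; rewrite ?memvf //.
move=> y; rewrite (eqP sigma_gen) => /cycleP[i ->].
by rewrite -iter_sigma; elim: i => //= i ->.
Qed.

Lemma order_sigma : #[sigma]%g = n.
Proof.
have /galois_dim : galois 1 {:L} := @finField_galois K L 1%AS {:L}%AS (sub1v _).
by rewrite dimv1 divn1 => ->; rewrite (eqP sigma_gen) orderE.
Qed.

Lemma iter_sigma_eq i j :
  (forall x, iter i sigma x = iter j sigma x) -> i = j %[mod n].
Proof.
move=> eij; apply/eqP; rewrite -order_sigma -eq_expg_mod_order.
by apply/gal_eqP => x _; rewrite -!iter_sigma.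
Qed.

Lemma iter_sigma_mod i j x : i = j %[mod n] -> iter i sigma x = iter j sigma x.
Proof.
move=> eij; rewrite !iter_sigma; congr (gal_repr _ x).
by apply/eqP; rewrite eq_expg_mod_order order_sigma; apply/eqP.
Qed.

(** The Frobenius map also generates the Galois group, cyclic of order n; its c-th power is a
    generator exactly when c is prime to n. *)
Lemma sigma_frob : exists2 c, coprime c n & forall x, sigma x = x ^+ (#|K| ^ c).
Proof.
have [alpha ga ea] := finField_galois_generator (sub1v {:L}%AS).
rewrite /= dimv1 expn1 in ea.
have : sigma \in <[alpha]>%g.
  by rewrite -(eqP ga) (eqP sigma_gen) cycle_id.
case/cycleP=> c ec; exists c.
  have oa : #[alpha]%g = n.
    by rewrite -order_sigma !orderE -(eqP ga) (eqP sigma_gen).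
  rewrite -oa coprime_sym -(generator_coprime alpha) -ec /generator.
  by rewrite -(eqP ga) -(eqP sigma_gen).
move=> x; rewrite ec -iter_sigma; elim: c {ec} => [|c IH] /=.
  by rewrite expn0 expr1.
by rewrite IH ea ?memvf // -exprM expnSr.
Qed.

Lemma expr_card_ext (x : L) : x ^+ (#|K| ^ n) = x.
Proof.
by apply/eqP; rewrite -(Fermat's_little_theorem {:L}%AS) memvf.
Qed.

(** The norm is the power map with exponent N = (q^n - 1)/(q - 1). If c = w^i with [w] generating
    the units of L, then c^(q-1) = 1 forces N to divide i, and w^(i/N) has norm c. *)
Lemma norm_surj (c : K) : c != 0 ->
  exists2 u : L, u != 0 & \prod_(j < n) iter j sigma u = c%:A.
Proof.
move=> c0; have [w ew ow] := finField_pow_gen (finvect_type L : finFieldType).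
have q1 : (1 < #|K|)%N by apply: finNzRing_gt1.
have cL : #|finvect_type L| = (#|K| ^ n)%N.
  rewrite -(@card_vspace K _ _ {:finvect_type L}%VS).
  by apply: eq_card => x; rewrite memvf.
have [i ei] : exists i, c%:A = (w : L) ^+ i.
  by apply: ew; rewrite scaler_eq0 (negPf c0) oner_eq0.
pose N := (\sum_(j < n) #|K| ^ j)%N.
have eN : (#|K|.-1 * N)%N = (#|K| ^ n).-1 by rewrite /N -predn_exp.
have /dvdnP[m em] : (N %| i)%N.
  have : (w : L) ^+ (i * #|K|.-1) = 1.
    rewrite exprM -ei -in_algE -rmorphXn /=.
    suff -> : c ^+ #|K|.-1 = 1 by rewrite scale1r.
    apply: (mulfI c0).
    rewrite -[_ * _]exprS prednK ?expf_card ?mulr1 //; exact: ltnW.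
  move/ow; rewrite cL -eN mulnC dvdn_pmul2r //.
  by rewrite -ltnS prednK // ltnW.
exists ((w : L) ^+ m).
  apply/eqP => wm0; have : c%:A != 0 :> L by rewrite scaler_eq0 (negPf c0) oner_eq0.
  rewrite ei em exprM wm0 expr0n; case: (N =P 0%N); last by rewrite mulr0n eqxx.
  move=> N0; move: eN; rewrite N0 muln0 => /esym/eqP.
  rewrite -leqn0 leqNgt -ltnS prednK ?expn_gt0 ?(ltnW q1) //.
  by rewrite -[1%N](expn0 #|K|) ltn_exp2l // adim_gt0.
have [alpha ga ea] := finField_galois_generator (sub1v {:L}%AS).
rewrite /= dimv1 expn1 in ea.
have ea' j x : iter j alpha x = x ^+ (#|K| ^ j).
  by elim: j => [|j IH] /=; rewrite ?expn0 ?expr1 // IH ea ?memvf // -exprM expnSr.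
have oa : #[alpha]%g = n.
  by rewrite -order_sigma !orderE -(eqP ga) (eqP sigma_gen).
rewrite ei em exprM.
(* The product over iterates of [sigma] runs over the whole group, so [sigma] can be traded for the
   Frobenius generator, whose iterates are explicit powers. *)
transitivity (\prod_(x in 'Gal({:L} / 1)%g) gal_repr x (w ^+ m)).
  rewrite (eqP sigma_gen) prod_cycle order_sigma.
  by apply: eq_bigr => j _; rewrite iter_sigma.
rewrite (eqP ga) prod_cycle oa -[RHS]prodrXr.
by apply: eq_bigr => j _; rewrite -iter_sigma ea'.
Qed.

End FiniteExtension.

(** F is viewed as an extension of its prime field, which every ring endomorphism fixes; there the
    Frobenius generates the Galois group. *)
Lemma rmorph_frobenius (F : finFieldType) (p r : nat) (t : {rmorphism F -> F}) :
    p \in [pchar F] -> #|F| = (p ^ r)%N -> (0 < r)%N ->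
  exists2 j, (j < r)%N & forall x, t x = x ^+ (p ^ j).
Proof.
move=> pF cF r0; have p_pr := pcharf_prime pF.
pose F1 := pPrimeCharType pF.
have [alpha ga ea] := finField_galois_generator (sub1v {:F1}%AS).
rewrite /= dimv1 expn1 card_Fp // in ea.
have tK (c : 'F_p) : (t : {rmorphism F1 -> F1}) c%:A = c%:A.
  by rewrite -[c%:A]/((c : nat)%:R * 1 : F1) mulr1 rmorph_nat.
have [i ei] := rmorph_gal ga tK.
have dF : \dim {:F1} = r.
  rewrite pprimeChar_dimf.
  by rewrite [#|_|]cF pfactorK.
exists (i %% r)%N => [|x]; first by rewrite ltn_mod.
rewrite [LHS](ei x) -(@iter_sigma_mod _ _ _ ga (i %% r)) ?dF ?modn_mod //.
elim: (i %% r)%N => [|j IH] /=; first by rewrite expn0 expr1.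
by rewrite IH ea ?memvf // -exprM expnSr.
Qed.

(** * A compositum of L and E over K, and its degree over E *)

Section Compositum.

Variables (K : finFieldType) (L : splittingFieldType K).
Variables (E : finFieldType) (j : {rmorphism K -> E}) (s : nat).
Hypothesis card_E : #|E| = (#|K| ^ s)%N.

(** L = K(w), where w has minimal polynomial [g]; M is the splitting field over E of the image of
    [g], and [iota] sends w to one of its roots [z0]. *)
Lemma compositum :
  exists (M : splittingFieldType E) (iota : {rmorphism L -> M}),
    (forall c : K, iota c%:A = (j c)%:A) /\
    \dim {:M} = (\dim {:L} %/ gcdn (\dim {:L}) s)%N.
Proof.
have [w ew _] := finField_pow_gen (finvect_type L : finFieldType).
rewrite -/L in w ew.
have [g eg] : exists g : {poly K}, map_poly (in_alg L) g = minPoly 1 w.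
  by have /polyOver1P[g eg] := minPolyOver 1 w; exists g.
have g0 : g != 0.
  by rewrite -(map_poly_eq0 (in_alg L)) eg monic_neq0 ?monic_minPoly.
have g_dvd (P : {poly K}) : (map_poly (in_alg L) P).[w] = 0 -> g %| P.
  move=> Pw; rewrite -(dvdp_map (in_alg L)) eg minPoly_dvdp //.
    by apply/polyOver1P; exists P.
  exact/rootP.
have polyw (l : L) : exists P : {poly K}, (map_poly (in_alg L) P).[w] == l.
  have [->|l0] := eqVneq l 0; first by exists 0; rewrite rmorph0 horner0.
  have [i ->] := ew l l0.
  by exists 'X^i; rewrite map_polyXn hornerXn.
pose P l := xchoose (polyw l).
have PP l : (map_poly (in_alg L) (P l)).[w] = l := eqP (xchooseP (polyw l)).
have gE0 : map_poly j g != 0 by rewrite map_poly_eq0.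
have [M [zs ezs eM]] := FinSplittingFieldFor gE0.
rewrite -map_poly_comp /= in ezs.
pose h : {rmorphism K -> M} := in_alg M \o j.
rewrite -/h in ezs.
have [z0 z0zs] : exists z0, z0 \in zs.
  case: (zs) ezs => [|z zs' _]; last by exists z; rewrite inE eqxx.
  rewrite big_nil => /eqp_size; rewrite size_poly1 size_map_poly.
  rewrite -(size_map_poly (in_alg L)) eg => e1.
  by have := root_minPoly 1 w; rewrite (size1_polyC (eq_leq e1)) rootC;
    move: (root_size_gt1 (monic_neq0 (monic_minPoly 1 w)) (root_minPoly 1 w));
      rewrite e1.
have root_zs z : z \in zs -> root (map_poly h g) z.
  by move=> zz; rewrite (eqp_root ezs) root_prod_XsubC.
pose f l := (map_poly h (P l)).[z0].
(* Two polynomials expressing [l] in terms of [w] differ by a multiple of [g], so the value at [z0]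
   depends on [l] only; hence [f] is a ring morphism. *)
have f_eq (Q : {poly K}) l : (map_poly (in_alg L) Q).[w] = l ->
    (map_poly h Q).[z0] = f l.
  move=> Ql; apply/eqP; rewrite -subr_eq0 /f -hornerN -hornerD -rmorphB.
  have /dvdpP[R ->] : g %| Q - P l.
    by apply: g_dvd; rewrite rmorphB hornerD hornerN Ql PP subrr.
  by rewrite rmorphM hornerM (rootP (root_zs _ z0zs)) mulr0.
have fB : zmod_morphism f.
  move=> x y; rewrite -(@f_eq (P x - P y)) ?rmorphB ?hornerD ?hornerN ?PP //.
have fM : monoid_morphism f.
  split=> [|x y]; first by rewrite -(@f_eq 1) ?rmorph1 ?hornerC.
  by rewrite -(@f_eq (P x * P y)) ?rmorphM ?hornerM ?PP.
pose iota : {rmorphism L -> M} := HB.pack f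
  (GRing.isZmodMorphism.Build L M f fB) (GRing.isMonoidMorphism.Build L M f fM).
have iota_w : iota w = z0.
  by rewrite /= -(@f_eq 'X) ?map_polyX ?hornerX.
exists M, iota; split=> [c|].
  by rewrite /= -(@f_eq c%:P) ?map_polyC ?hornerC.
(* The degree of M over E is the order of x |-> x^|E|, which can be read off on the
   roots of g: its i-th power is trivial iff n divides s i. *)
have [alpha ga ea] := finField_galois_generator (sub1v {:M}%AS).
rewrite /= dimv1 expn1 in ea.
have [beta gb eb] := finField_galois_generator (sub1v {:L}%AS).
rewrite /= dimv1 expn1 in eb.
have ea' i x : iter i alpha x = x ^+ (#|K| ^ (s * i)).
  elim: i => [|i IH] /=; first by rewrite muln0 expn0 expr1.
  by rewrite IH ea ?memvf // card_E -exprM -expnD mulnS addnC.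
have eb' i x : iter i beta x = x ^+ (#|K| ^ i).
  by elim: i => [|i IH] /=; rewrite ?expn0 ?expr1 // IH eb ?memvf // -exprM expnSr.
have oP i : (\dim {:M} %| i)%N = (\dim {:L} %| s * i)%N.
  apply/idP/idP => [/eqP di|/dvdnP[m em]].
    have aid x : iter i alpha x = x.
      by rewrite (@iter_sigma_mod _ _ _ ga i 0) // mod0n.
    apply/eqP; rewrite -(mod0n (\dim {:L})); apply: (iter_sigma_eq gb) => x /=.
    rewrite eb'; have [->|x0] := eqVneq x 0;
      first by rewrite expr0n gtn_eqF // expn_gt0 ltnW ?finNzRing_gt1.
    have [k ->] := ew x x0; rewrite -exprM mulnC exprM; congr (_ ^+ k).
    by apply: (fmorph_inj iota); rewrite rmorphXn iota_w -ea' aid.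
  rewrite -(order_sigma ga) order_dvdn; apply/eqP.
  (* The fixed field of [alpha ^+ i] contains the roots of [g], which generate M over E. *)
  have defE : fixedSpace (gal_repr (alpha ^+ i)%g) = {:M}%VS.
    apply/eqP; rewrite eqEsubv subvf -eM -[fixedSpace _]subfield_closed agenvS //.
    rewrite subv_add sub1v; apply/span_subvP=> z zz.
    apply/fixedSpaceP; rewrite -iter_sigma ea' em.
    have zq : z ^+ (#|K| ^ \dim {:L}) = z.
      have /dvdpP[Q eQ] : g %| 'X^(#|K| ^ \dim {:L}) - 'X.
        by apply: g_dvd; rewrite rmorphB /= map_polyXn map_polyX !hornerE
          expr_card_ext subrr.
      apply/eqP; rewrite -subr_eq0; apply/eqP.
      transitivity (map_poly h ('X^(#|K| ^ \dim {:L}) - 'X)).[z].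
        by rewrite rmorphB /= map_polyXn map_polyX !hornerE.
      by rewrite eQ rmorphM hornerM (rootP (root_zs _ zz)) mulr0.
    elim: m {em} => [|m IH]; first by rewrite mul0n expn0 expr1.
    by rewrite mulSn expnD exprM zq IH.
  apply/eqP/gal_eqP => x _; rewrite gal_id; apply/fixedSpaceP.
  by rewrite defE memvf.
have L0 : (0 < \dim {:L})%N by rewrite adim_gt0.
set d := gcdn _ _.
have d0 : (0 < d)%N by rewrite gcdn_gt0 L0.
have oP' i : (\dim {:M} %| i)%N = (\dim {:L} %/ d %| i)%N.
  rewrite oP -{1}(divnK (dvdn_gcdl (\dim {:L}) s)) -/d.
  rewrite -{1}(divnK (dvdn_gcdr (\dim {:L}) s)) -/d mulnAC dvdn_pmul2r //.
  rewrite Gauss_dvdr // /coprime -(eqn_pmul2r d0) muln_gcdl.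
  by rewrite !divnK ?dvdn_gcdl ?dvdn_gcdr // mul1n.
by apply/eqP; rewrite eqn_dvd oP' dvdnn -oP' dvdnn.
Qed.

End Compositum.

(** * A module of dimension n over F_(q^s) *)
Section MatrixModel.

Import VectorInternalTheory.

Variables (K : finFieldType) (L : splittingFieldType K) (sigma : gal_of {:L}).
Hypothesis sigma_gen : generator 'Gal({:L} / 1)%g sigma.
Variables (E : finFieldType) (j : {rmorphism K -> E}) (s : nat).

Local Notation n := (\dim {:L}).

(** Matrices act on row vectors from the right, which reverses composition; the transpose in [mx]
    restores the order. *)
Lemma operators_to_mx (V : vectType E) (m : nat)
    (act : L -> V -> V) (T : V -> V) (y : E) :
    \dim {:V} = m ->
    (forall l, linear (act l)) -> linear T ->
    (forall l l' v, act (l - l') v = act l v - act l' v) ->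
    (forall l l' v, act (l * l') v = act l (act l' v)) ->
    (forall (c : K) v, act c%:A v = j c *: v) ->
    (forall l v, T (act l v) = act (sigma l) (T v)) ->
    (forall v, iter n T v = y *: v) ->
  exists (f : {rmorphism L -> 'M[E]_m}) (x : 'M[E]_m),
    [/\ forall c : K, f c%:A = (j c)%:M,
        forall l, x * f l = f (sigma l) * x & x ^+ n = y%:M].
Proof.
rewrite dimvf => <- actL TL actB actM actK Tact Tn.
pose mx (h : V -> V) : 'M[E]_(dim V) :=
  (\matrix_i v2r (h (r2v (delta_mx 0 i))))^T.
have mxE h (u : 'rV_(dim V)) : linear h -> u *m (mx h)^T = v2r (h (r2v u)).
  move=> hl; rewrite trmxK.
  pose lh : {linear V -> V} := HB.pack h (GRing.isLinear.Build E V V *:%R h hl).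
  rewrite -[h]/(lh : V -> V) [in RHS](row_sum_delta u) !linear_sum mulmx_sum_row.
  by apply: eq_bigr => i _; rewrite rowK !linearZ.
have mx_inj (A B : 'M[E]_(dim V)) :
    (forall u : 'rV_(dim V), u *m A^T = u *m B^T) -> A = B.
  move=> e; apply: trmx_inj; apply/row_matrixP => i.
  by rewrite !rowE e.
pose f0 l := mx (act l).
have f0B : zmod_morphism f0.
  move=> l l'; apply: mx_inj => u.
  by rewrite linearB mulmxBr !mxE // actB linearB.
have f0M : monoid_morphism f0.
  split=> [|l l']; apply: mx_inj => u.
    by rewrite -[1 in LHS]scale1r mxE // actK rmorph1 scale1r r2vK trmx1 mulmx1.
  by rewrite trmx_mul mulmxA !mxE // v2rK -actM mulrC.
pose f : {rmorphism L -> 'M[E]_(dim V)} := HB.pack f0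
  (GRing.isZmodMorphism.Build L _ f0 f0B) (GRing.isMonoidMorphism.Build L _ f0 f0M).
exists f, (mx T); split=> [c|l|].
- apply: mx_inj => u; rewrite mxE // actK tr_scalar_mx mul_mx_scalar.
  by rewrite linearZ /= r2vK.
- by apply: mx_inj => u; rewrite !trmx_mul !mulmxA !mxE // !v2rK Tact.
apply: mx_inj => u; rewrite tr_scalar_mx mul_mx_scalar.
rewrite -[in RHS](r2vK u) -linearZ -Tn.
elim: (n) => [|k IH] /=; first by rewrite expr0 trmx1 mulmx1 r2vK.
by rewrite exprS trmx_mul mulmxA IH mxE // v2rK.
Qed.

Hypothesis card_E : #|E| = (#|K| ^ s)%N.

(** The space M^d has dimension d n' = n over E. The d-th iterate of [T] acts on every component by
    v -> u tau(v), so the n-th iterate is multiplication by the norm of [u] down to E, chosen to be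
    [y]. *)
Lemma skew_matrices (y : E) : y != 0 -> (0 < s)%N ->
  exists (f : {rmorphism L -> 'M[E]_n}) (x : 'M[E]_n),
    [/\ forall c : K, f c%:A = (j c)%:M,
        forall l, x * f l = f (sigma l) * x & x ^+ n = y%:M].
Proof.
move=> y0 s0.
have [M [iota [iotaK dM]]] := compositum L j card_E.
set d := gcdn _ _ in dM; set n' := \dim {:M} in dM.
have n0 : (0 < n)%N by rewrite adim_gt0.
have d0 : (0 < d)%N by rewrite gcdn_gt0 n0.
have dn : (d %| n)%N by rewrite dvdn_gcdl.
have en : (d * n' = n)%N by rewrite dM mulnC divnK.
have le_dn : (d <= n)%N by rewrite dvdn_leq.
have [c co_c ec] := sigma_frob sigma_gen.
(* [tau] = [alpha ^+ e] must generate Gal(M/E) and restrict to sigma^d on L. There the two maps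
   raise to the powers q^(s e) and q^(c d), whence the congruence; [e] is c times an inverse of s/d
   modulo n'. *)
have [e co_e ee] : exists2 e, coprime n' e & (s * e = c * d %[mod n])%N.
  pose s' := (s %/ d)%N.
  have es : (d * s' = s)%N by rewrite mulnC divnK // dvdn_gcdr.
  have s'0 : (0 < s')%N by move: s0; rewrite -es muln_gt0 => /andP[].
  have co : coprime s' n'.
    rewrite /coprime -(eqn_pmul2l d0) muln_gcdr en es muln1 gcdnC //.
  pose a := (egcdn s' n').1.
  have ea : (s' * (c * a) = c %[mod n'])%N.
    rewrite /a; case: egcdnP => // km kn /= e1 _.
    rewrite mulnC -mulnA e1 (eqP co) mulnDr muln1 mulnA.
    by rewrite modnMDl.
  exists (c * a)%N.
    have : coprime n' (s' * (c * a)).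
      rewrite coprime_sym -coprime_modl ea coprime_modl.
      by apply: coprime_dvdr co_c; rewrite -en dvdn_mull.
    by rewrite coprimeMr => /andP[].
  by rewrite -es -en -mulnA (mulnC c d) -!muln_modr ea.
have [alpha ga ea] := finField_galois_generator (sub1v {:M}%AS).
rewrite /= dimv1 expn1 in ea.
pose tau := (alpha ^+ e)%g.
have gtau : generator 'Gal({:M} / 1)%g tau.
  by rewrite (eqP ga) generator_coprime (order_sigma ga).
have itE i x : iter i alpha x = x ^+ (#|K| ^ (s * i)).
  elim: i => [|i IH] /=; first by rewrite muln0 expn0 expr1.
  by rewrite IH ea ?memvf // card_E -exprM -expnD mulnS addnC.
have [beta gb eb] := finField_galois_generator (sub1v {:L}%AS).
rewrite /= dimv1 expn1 in eb.
have eb' i x : iter i beta x = x ^+ (#|K| ^ i).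
  by elim: i => [|i IH] /=; rewrite ?expn0 ?expr1 // IH eb ?memvf // -exprM expnSr.
have esd i x : iter i sigma x = x ^+ (#|K| ^ (c * i)).
  elim: i => [|i IH] /=; first by rewrite muln0 expn0 expr1.
  by rewrite IH ec -exprM -expnD mulnS addnC.
have tau_iota l : tau (iota l) = iota (iter d sigma l).
  rewrite /tau -iter_sigma itE -rmorphXn esd -!eb'; congr (iota _).
  exact: (iter_sigma_mod gb).
have [u u0 Nu] := norm_surj gtau y0.
(* L acts on the i-th component through sigma^-i, written sigma^(n - i), so that
   the shift T is sigma-semilinear; tau makes this consistent after d steps. *)
pose V := {ffun 'I_d -> M}.
pose pm k : 'I_d := Ordinal (ltn_pmod k d0).
pose act l (v : V) : V := [ffun i : 'I_d => iota (iter (n - i) sigma l) * v i].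
pose T (v : V) : V := [ffun i : 'I_d =>
  if i == 0%N :> nat then u * tau (v (pm (i + d - 1)%N)) else v (pm (i + d - 1)%N)].
have ord_predE (i : 'I_d) :
    ((i + d - 1) %% d = if i == 0%N :> nat then d - 1 else i - 1)%N.
  have id := ltn_ord i; case: eqP => [->|/eqP i0].
    by rewrite add0n modn_small ?ltn_subrL ?d0.
  by rewrite addnC -addnBA ?lt0n // modnDl modn_small //; clear -id; lia.
have pmE k l : k = l %[mod d] -> pm k = pm l by move=> e1; apply: val_inj.
have iotaZ (a : K) (x : M) : iota a%:A * x = j a *: x.
  by rewrite iotaK mulr_algl.
apply: (operators_to_mx (act := act) (T := T)).
- rewrite [LHS]dimvf -en /n' [\dim {:M}]dimvf -[LHS]/(#|'I_d| * dim M)%N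
  card_ord; reflexivity.
- move=> l a v w; apply/ffunP => i; rewrite !ffunE.
  by rewrite mulrDr scalerAr.
- move=> a v w; apply/ffunP => i; rewrite !ffunE.
  case: eqP => // _; rewrite linearP mulrDr scalerAr //.
- move=> l l' v; apply/ffunP => i; rewrite !ffunE.
  by rewrite !iter_sigma !rmorphB mulrBl.
- move=> l l' v; apply/ffunP => i; rewrite !ffunE.
  by rewrite !iter_sigma !rmorphM mulrA.
- move=> a v; apply/ffunP => i; rewrite !ffunE.
  rewrite -iotaZ; congr (iota _ * _).
  by rewrite iter_sigma -in_algE rmorph_alg.
- move=> l v; apply/ffunP => i; rewrite !ffunE -iterSr.
  case: eqP => [->|/eqP i0].
    rewrite /= add0n subn0 modn_small ?ltn_subrL ?d0 //.
    rewrite rmorphM /= tau_iota -iterD mulrCA; congr (iota _ * _).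
    by rewrite -iterS; congr (iter _ _ _); clear -d0 le_dn; lia.
  congr (iota _ * _) => /=.
  rewrite ord_predE (negPf i0) -iterS; congr (iter _ _ _).
  by have := ltn_ord i; clear -i0 le_dn; lia.
move=> v.
(* After k steps the components of index below k have wrapped around once, picking up [u] and [tau];
   adding [d] before subtracting avoids truncation. *)
have Tk k (w : V) i : (k <= d)%N -> iter k T w i =
    if (k <= i)%N then w (pm (i + d - k)%N) else u * tau (w (pm (i + d - k)%N)).
  elim: k i => [|k IH] i kd /=.
    by rewrite subn0; congr (w _); apply: val_inj; rewrite /= modnDr modn_small.
  rewrite ffunE IH ?(ltnW kd) //= ord_predE; case: eqP => [->|/eqP i0].
    rewrite ltn0 (_ : k <= d - 1)%N; last by clear -kd; lia.
    congr (u * tau (w _)); apply: pmE.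
    have -> : (d - 1 + d - k = 0 + d - k.+1 + d)%N by clear -kd; lia.
    by rewrite modnDr.
  have -> : (k <= i - 1)%N = (k.+1 <= i)%N by clear -i0; lia.
  by have -> : (i - 1 + d - k = i + d - k.+1)%N by clear -i0; lia.
have Td (w : V) i : iter d T w i = u * tau (w i).
  rewrite Tk // leqNgt ltn_ord /=; congr (u * tau (w _)); apply: val_inj.
  by rewrite /= addnK modn_small.
have Tdm k (w : V) i : iter (d * k) T w i =
    \prod_(l < k) iter l tau u * iter k tau (w i).
  elim: k i => [|k IH] i; first by rewrite muln0 big_ord0 mul1r.
  rewrite mulnS iterD Td IH rmorphM rmorph_prod big_ord_recl /= mulrA.
  by congr (_ * _ * _); apply: eq_bigr => l _; rewrite add1n.
apply/ffunP => i; rewrite -en Tdm Nu !ffunE mulr_algl.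
by rewrite (@iter_sigma_mod _ _ _ gtau n' 0) // modnn mod0n.
Qed.
End MatrixModel.

(** * The quotient ring R_F *)
Lemma poly_pad_size (R : nzSemiRingType) N (p : {poly R}) : (size p <= N)%N ->
  p = \sum_(i < N) p`_i *: 'X^i.
Proof.
move=> pN; rewrite -poly_def; apply/polyP => i; rewrite coef_poly.
by case: ltnP => // h; rewrite nth_default // (leq_trans pN).
Qed.

Section SkewRing.

Variables (K : finFieldType) (L : splittingFieldType K) (sigma : gal_of {:L}).
Hypothesis sigma_gen : generator 'Gal({:L} / 1)%g sigma.

Local Notation n := (\dim {:L}).
Local Notation skewM := (skew_mul (gal_repr sigma)).

(** F(X^n) as an ordinary polynomial. Its coefficients are fixed by [sigma], so skew multiplication
    by it on the right is ordinary multiplication, and membership in the ideal becomes ordinary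
    divisibility. *)
Definition comp_Xn (F : {poly K}) : {poly L} := map_poly (in_alg L) F \Po 'X^n.

Fact comp_Xn_is_zmod_morphism : zmod_morphism comp_Xn.
Proof. by move=> F G; rewrite /comp_Xn !rmorphB. Qed.

Fact comp_Xn_is_monoid_morphism : monoid_morphism comp_Xn.
Proof.
by split=> [|F G]; rewrite /comp_Xn ?rmorphM ?rmorph1 ?comp_polyM // comp_polyC.
Qed.

HB.instance Definition _ := GRing.isZmodMorphism.Build {poly K} {poly L}
  comp_Xn comp_Xn_is_zmod_morphism.
HB.instance Definition _ := GRing.isMonoidMorphism.Build {poly K} {poly L}
  comp_Xn comp_Xn_is_monoid_morphism.

Lemma dimL_gt0 : (0 < n)%N. Proof. exact: adim_gt0. Qed.

Lemma comp_XnE F : comp_Xn F = \sum_(i < size F) (F`_i)%:A *: 'X^(n * i).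
Proof.
rewrite /comp_Xn comp_polyE size_map_poly; apply: eq_bigr => i _.
by rewrite coef_map /= exprM.
Qed.

Lemma size_comp_Xn F : F != 0 -> size (comp_Xn F) = ((size F).-1 * n).+1.
Proof.
move=> F0; have : comp_Xn F != 0.
  by rewrite comp_poly_eq0 ?map_poly_eq0 // size_polyXn ltnS dimL_gt0.
rewrite -size_poly_gt0 => /prednK <-; congr _.+1.
by rewrite size_comp_poly size_map_poly size_polyXn.
Qed.

Lemma map_comp_Xn i F : map_poly (iter i sigma) (comp_Xn F) = comp_Xn F.
Proof.
rewrite /comp_Xn map_comp_poly map_polyXn -map_poly_comp.
congr (_ \Po _); apply: eq_map_poly => c /=.
by rewrite iter_sigma -in_algE rmorph_alg.
Qed.

Lemma skew_mul_comp_Xn q F : skewM q (comp_Xn F) = q * comp_Xn F.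
Proof.
rewrite /skew_mul [in RHS](poly_sum_coef q) mulr_suml; apply: eq_bigr => i _.
by rewrite map_comp_Xn -scalerAl mulrC.
Qed.

Lemma skew_mul_Xn q i : skewM q 'X^i = q * 'X^i.
Proof.
rewrite /skew_mul [in RHS](poly_sum_coef q) mulr_suml; apply: eq_bigr => j _.
by rewrite map_polyXn -scalerAl mulrC.
Qed.

Lemma coef_skew_mulC q l i : (skewM q l%:P)`_i = q`_i * iter i sigma l.
Proof.
rewrite /skew_mul.
under eq_bigr => k _ do rewrite map_polyC mul_polyC scalerA.
rewrite -(poly_def _ (fun k => q`_k * iter k sigma l)) coef_poly.
by case: ltnP => // h; rewrite nth_default // mul0r.
Qed.

Lemma coef_comp_Xn F i :
  (comp_Xn F)`_i = if (n %| i)%N then (F`_(i %/ n))%:A else 0.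
Proof.
rewrite /comp_Xn coef_comp_poly_Xn ?dimL_gt0 //; case: ifP => // _.
by rewrite coef_map.
Qed.

Lemma val_eval_Xn F : skew_val (eval_Xn sigma F) = comp_Xn F.
Proof.
rewrite comp_XnE raddf_sum; apply: eq_bigr => i _.
by rewrite /= skewXn skew_mulZl skew_mul1l.
Qed.

Lemma ideal_comp_Xn F f : (f \in @ideal_Xn K L sigma F) = (comp_Xn F %| skew_val f).
Proof.
apply/ideal_XnP/dvdpP => [[g ->]|[q eq]].
  by exists (skew_val g); rewrite /= val_eval_Xn skew_mul_comp_Xn.
by exists (SkewPoly _ q); apply: val_inj; rewrite /= val_eval_Xn skew_mul_comp_Xn.
Qed.

Section Quotient.

Variable F : {poly K}.
Local Notation RF := (skew_quot sigma F).
Local Notation PF := (comp_Xn F).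

Definition qpi (p : {poly L}) : RF := skew_pi sigma F (SkewPoly _ p).

Fact qpi_is_zmod_morphism : zmod_morphism qpi.
Proof. by move=> p q; rewrite /qpi -rmorphB. Qed.

HB.instance Definition _ := GRing.isZmodMorphism.Build {poly L} RF
  qpi qpi_is_zmod_morphism.

Lemma qpiM p q : qpi (skewM p q) = qpi p * qpi q.
Proof. by rewrite /qpi -rmorphM. Qed.

Lemma qpi_eq p q : (qpi p == qpi q) = (PF %| p - q).
Proof. by rewrite /qpi [LHS]ts_pi_eq ideal_comp_Xn. Qed.

Definition qlift (y : RF) : skewpoly (gal_repr sigma) :=
  @ts_repr _ _ (@ideal_Xn_left K L sigma F) (@ideal_Xn_right K L sigma F) y.

Lemma qliftK y : qpi (skew_val (qlift y)) = y.
Proof.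
rewrite /qpi (_ : SkewPoly _ (skew_val (qlift y)) = qlift y); last exact: val_inj.
exact: ts_reprK.
Qed.

(** The reduced representative; the ordinary remainder serves, as the ideal consists of the ordinary
    multiples of F(X^n). *)
Definition qrep (y : RF) : {poly L} := skew_val (qlift y) %% PF.

Lemma qrepK : cancel qrep qpi.
Proof.
move=> y; rewrite -[RHS]qliftK; apply/eqP; rewrite qpi_eq /qrep.
set p := skew_val _; rewrite {2}(divp_eq p PF) opprD addrCA subrr addr0.
by rewrite dvdpNr dvdp_mull.
Qed.

Definition qscal (a : L) : RF := qpi a%:P.
Definition qX : RF := qpi 'X.

Fact qscal_is_zmod_morphism : zmod_morphism qscal.
Proof. by move=> a b; rewrite /qscal !raddfB. Qed.

Fact qscal_is_monoid_morphism : monoid_morphism qscal.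
Proof.
split=> [|a b]; first by [].
rewrite /qscal -qpiM; congr qpi.
by rewrite -[a%:P in RHS]alg_polyC skew_mulZl skew_mul1l polyCM mul_polyC.
Qed.

HB.instance Definition _ := GRing.isZmodMorphism.Build L RF
  qscal qscal_is_zmod_morphism.
HB.instance Definition _ := GRing.isMonoidMorphism.Build L RF
  qscal qscal_is_monoid_morphism.

Lemma qscalM a b : qscal (a * b) = qscal a * qscal b.
Proof. exact: rmorphM. Qed.

Lemma qscalXn a i : qscal (a ^+ i) = qscal a ^+ i.
Proof. exact: rmorphXn. Qed.

Lemma qpiZ a p : qpi (a *: p) = qscal a * qpi p.
Proof. by rewrite /qscal -qpiM -alg_polyC skew_mulZl skew_mul1l. Qed.

Lemma qpiXn i : qpi 'X^i = qX ^+ i.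
Proof.
elim: i => [|i IH]; first by rewrite !expr0.
by rewrite !exprSr -IH -qpiM -[X in skewM _ X]expr1 skew_mul_Xn.
Qed.

Lemma qpiE N (p : {poly L}) : (size p <= N)%N -> qpi p = \sum_(i < N) qscal
  p`_i * qX ^+ i.
Proof.
move=> pN; rewrite [in LHS](poly_pad_size pN) raddf_sum.
by apply: eq_bigr => i _; rewrite /= qpiZ qpiXn.
Qed.

Lemma qX_scal i a : qX ^+ i * qscal a = qscal (iter i sigma a) * qX ^+ i.
Proof.
by rewrite -qpiXn /qscal -!qpiM skew_mulXnl skew_mul_Xn map_polyC.
Qed.

Lemma qpi_comp_Xn : qpi PF = 0.
Proof. by apply/eqP; rewrite -(raddf0 qpi) qpi_eq subr0. Qed.

Lemma skew_codeP s k y :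
  skew_code sigma s k F y <-> exists2 p : {poly L}, (size p <= s * k)%N & y = qpi p.
Proof.
split=> [[a _ <-]|[p sp ->]].
  exists (\poly_(i < s * k) (if insub i is Some i' then a i' else 0)).
    exact: size_poly.
  rewrite /qpi; congr (skew_pi _ _ _); apply: val_inj => /=.
  rewrite raddf_sum poly_def; apply: eq_bigr => i _ /=.
  by rewrite valK /= skewXn skew_mulZl skew_mul1l.
exists (fun i => p`_i) => //.
rewrite /qpi; congr (skew_pi _ _ _); apply: val_inj => /=.
rewrite raddf_sum [RHS](poly_pad_size sp); apply: eq_bigr => i _.
by rewrite /= skewXn skew_mulZl skew_mul1l.
Qed.

End Quotient.
End SkewRing.

(** * Evaluation of skew polynomials at an element commuting with L as X does *)

Section SkewHom.

Variables (K : finFieldType) (L : splittingFieldType K) (sigma : gal_of {:L}).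
Hypothesis sigma_gen : generator 'Gal({:L} / 1)%g sigma.
Local Notation n := (\dim {:L}).
Local Notation skewM := (skew_mul (gal_repr sigma)).
Local Notation qpi := (qpi sigma).

Variables (A : pzRingType) (f : {rmorphism L -> A}) (a : A).
Hypothesis af : forall l, a * f l = f (sigma l) * a.

Lemma expf_twist i l : a ^+ i * f l = f (iter i sigma l) * a ^+ i.
Proof.
elim: i l => [|i IH] l; first by rewrite !expr0 mul1r mulr1.
by rewrite exprSr -mulrA af mulrA IH -iterSr mulrA.
Qed.

Definition skew_eval (p : {poly L}) : A := \sum_(i < size p) f p`_i * a ^+ i.

Lemma skew_eval_widen N (p : {poly L}) : (size p <= N)%N ->
  skew_eval p = \sum_(i < N) f p`_i * a ^+ i.
Proof.
move=> pN; rewrite /skew_eval (big_ord_widen N (fun i => f p`_i * a ^+ i)) //.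
rewrite big_mkcond; apply: eq_bigr => i _; case: ltnP => // h.
by rewrite nth_default // rmorph0 mul0r.
Qed.

Fact skew_eval_is_zmod_morphism : zmod_morphism skew_eval.
Proof.
move=> p q; pose N := maxn (size p) (size q).
have h1 : (size (p - q)%R <= N)%N by rewrite (leq_trans (size_polyD _ _)) //
  size_polyN.
rewrite (skew_eval_widen h1) !(@skew_eval_widen N) ?leq_maxl ?leq_maxr //.
by rewrite -sumrB; apply: eq_bigr => i _; rewrite coefB rmorphB mulrBl.
Qed.

HB.instance Definition _ := GRing.isZmodMorphism.Build {poly L} A
  skew_eval skew_eval_is_zmod_morphism.

Lemma skew_evalZ l p : skew_eval (l *: p) = f l * skew_eval p.
Proof.
rewrite !(@skew_eval_widen (size p)) ?size_scale_leq // mulr_sumr.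
by apply: eq_bigr => i _; rewrite coefZ rmorphM mulrA.
Qed.

Lemma skew_evalXn i : skew_eval 'X^i = a ^+ i.
Proof.
rewrite /skew_eval size_polyXn big_ord_recr /= coefXn eqxx rmorph1 mul1r.
by rewrite big1 ?add0r // => j _; rewrite coefXn ltn_eqF // rmorph0 mul0r.
Qed.

Lemma skew_evalM p q : skew_eval (skewM p q) = skew_eval p * skew_eval q.
Proof.
rewrite /skew_mul raddf_sum mulr_suml; apply: eq_bigr => i _ /=.
rewrite skew_evalZ -mulrA; congr (_ * _).
rewrite [q]poly_sum_coef !raddf_sum mulr_suml raddf_sum mulr_sumr.
apply: eq_bigr => j _ /=.
rewrite map_polyZ map_polyXn -scalerAl -exprD !skew_evalZ !skew_evalXn.
by rewrite mulrA expf_twist -mulrA -exprD addnC.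
Qed.

(** Evaluation at [a] is multiplicative and kills F(X^n), hence all its left multiples, so it
    factors through the quotient. *)
Lemma skew_quot_hom (F : {poly K}) :
    \sum_(i < size F) f (F`_i)%:A * a ^+ (n * i) = 0 ->
  exists Phi : {rmorphism skew_quot sigma F -> A},
    forall p, Phi (qpi F p) = skew_eval p.
Proof.
move=> Fa.
have ev0 : skew_eval (comp_Xn L F) = 0.
  rewrite comp_XnE raddf_sum -[RHS]Fa; apply: eq_bigr => i _ /=.
  by rewrite skew_evalZ skew_evalXn.
pose Phi (y : skew_quot sigma F) := skew_eval (qrep y).
have PhiE p : Phi (qpi F p) = skew_eval p.
  apply/eqP; rewrite -subr_eq0 -raddfB /=.
  have : qpi F (qrep (qpi F p)) == qpi F p by rewrite qrepK.
  rewrite qpi_eq => /dvdpP[q ->]; rewrite -(skew_mul_comp_Xn sigma).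
  by rewrite skew_evalM ev0 mulr0.
have PhiB : zmod_morphism Phi.
  by move=> y z; rewrite -[y]qrepK -[z]qrepK -rmorphB !PhiE raddfB.
have PhiM : monoid_morphism Phi.
  split=> [|y z].
    by rewrite -[1 in LHS]/(qpi F 'X^0) PhiE skew_evalXn expr0.
  by rewrite -[y]qrepK -[z]qrepK -qpiM !PhiE skew_evalM.
pose Phim : {rmorphism skew_quot sigma F -> A} := HB.pack Phi
  (GRing.isZmodMorphism.Build _ _ Phi PhiB)
  (GRing.isMonoidMorphism.Build _ _ Phi PhiM).
exists Phim.
exact: PhiE.
Qed.

End SkewHom.

(** * The quotient for irreducible F: reduced representatives, invertibility of X, simplicity *)

Section Irreducible.

Variables (K : finFieldType) (L : splittingFieldType K) (sigma : gal_of {:L}).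
Hypothesis sigma_gen : generator 'Gal({:L} / 1)%g sigma.
Local Notation n := (\dim {:L}).
Local Notation skewM := (skew_mul (gal_repr sigma)).
Local Notation qpi := (qpi sigma).
Local Notation qX := (qX sigma).
Local Notation qscal := (qscal sigma).

Variables (s : nat) (F : {poly K}).
Hypotheses (s_gt1 : (1 < s)%N) (irrF : irr_poly_pred s F).

Lemma size_PF : size (comp_Xn L F) = (s * n).+1.
Proof.
have /and3P[_ /eqP sF _] := irrF.
by rewrite size_comp_Xn ?sF // -size_poly_eq0 sF.
Qed.

Lemma qpi_inj (p q : {poly L}) : (size p <= s * n)%N -> (size q <= s * n)%N ->
  qpi F p = qpi F q -> p = q.
Proof.
move=> sp sq /eqP; rewrite qpi_eq => d.
apply/eqP; rewrite -subr_eq0; apply/eqP; apply: contraTeq d => /dvdp_leq d.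
apply/negP => /d; rewrite size_PF ltnNge => /negP; apply.
by rewrite (leq_trans (size_polyD _ _)) // geq_max size_polyN sp.
Qed.

Lemma size_qrep y : (size (@qrep K L sigma F y) <= s * n)%N.
Proof. by rewrite -ltnS -size_PF ltn_modp -size_poly_gt0 size_PF. Qed.

(** F(X^n) = Q X + F(0) with F(0) nonzero, so -F(0)^-1 Q is a left inverse of X. Its coefficients
    are fixed by [sigma], so it commutes with X and is a right inverse too. *)
Lemma qX_unit : exists2 x', x' * qX F = 1 & qX F * x' = 1.
Proof.
have F0 := irr_coef0 s_gt1 irrF.
have /and3P[_ /eqP sF _] := irrF.
pose Q := \poly_(i < s * n) (comp_Xn L F)`_i.+1.
have eP : comp_Xn L F = Q * 'X + (F`_0)%:A%:P.
  apply/polyP => -[|i].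
    rewrite coefD coefMX coefC /= add0r /comp_Xn.
    rewrite -horner_coef0 horner_comp hornerXn expr0n gtn_eqF ?dimL_gt0 //.
    by rewrite horner_coef0 coef_map.
  rewrite coefD coefMX coefC /= addr0 coef_poly; case: ltnP => // h.
  by rewrite nth_default // size_PF.
have eQ : map_poly sigma Q = Q.
  apply/polyP => i; rewrite coef_map !coef_poly /=; case: ifP => _;
    last exact: rmorph0.
  by rewrite -{2}(map_comp_Xn sigma 1 F) coef_map.
pose c := (- (F`_0)^-1)%:A : L.
have cF : c * (F`_0)%:A = -1.
  by rewrite /c -in_algE -in_algE -rmorphM mulNr mulVf // rmorphN rmorph1.
have h : qpi F (c *: Q * 'X) = 1.
  have -> : c *: Q * 'X = c *: comp_Xn L F + 1.
    have e : c *: (F`_0)%:A%:P = -1 by rewrite -mul_polyC -polyCM cF polyCN.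
    by rewrite eP scalerDr e subrK scalerAl.
  by rewrite raddfD /= qpiZ qpi_comp_Xn mulr0 add0r.
exists (qpi F (c *: Q)); rewrite -qpiM.
  by rewrite -[X in skewM _ X]expr1 skew_mul_Xn.
rewrite -{1}(expr1 'X) skew_mulXnl map_polyZ /= eQ -scalerAl expr1.
rewrite (_ : sigma c = c) ?scalerAl // /c -in_algE; exact: rmorph_alg.
Qed.

(* A monic q of least degree in the kernel is H(X^n) X^e with H over K, because
   q l - sigma^(deg q)(l) q and (X q - q X) X^-1 are kernel elements of smaller
   degree; but H would be coprime to F. *)
Lemma skew_quot_hom_inj (A : pzRingType) (Phi : {rmorphism skew_quot sigma F ->
  A}) :
  1 != 0 :> A -> injective Phi.
Proof.
move=> A1; have [x' x'x xx'] := qX_unit.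
have /and3P[_ /eqP sF /irreducibleP iF] := irrF.
suff inj0 (p : {poly L}) : (size p <= s * n)%N -> Phi (qpi F p) = 0 -> p = 0.
  move=> y z /eqP; rewrite -subr_eq0 -rmorphB -[y - z]qrepK => /eqP/(inj0 _
    (size_qrep _)).
  move=> e; apply/eqP; rewrite -subr_eq0 -[y - z]qrepK e raddf0 //.
pose J (m : nat) := `[< exists p : {poly L},
  [/\ size p = m.+1, p \is monic & Phi (qpi F p) = 0] >].
move=> sp Pp; apply/eqP; apply/negPn/negP => p0.
have exJ : exists m, J m.
  exists (size p).-1; apply/asboolP; exists ((lead_coef p)^-1 *: p); split.
  - by rewrite size_scale ?invr_eq0 ?lead_coef_eq0 // prednK ?size_poly_gt0.
  - by rewrite monicE lead_coefZ mulVf // lead_coef_eq0.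
  by rewrite qpiZ rmorphM Pp mulr0.
have Jmin (m : nat) q : Phi (qpi F q) = 0 -> (size q <= ex_minn exJ)%N -> q = 0.
  case: ex_minnP => D _ Dmin Pq sq; apply/eqP; apply/negPn/negP => q0.
  have : J (size q).-1.
    apply/asboolP; exists ((lead_coef q)^-1 *: q); split.
    - by rewrite size_scale ?invr_eq0 ?lead_coef_eq0 // prednK ?size_poly_gt0.
    - by rewrite monicE lead_coefZ mulVf // lead_coef_eq0.
    by rewrite qpiZ rmorphM Pq mulr0.
  by move/Dmin; rewrite leqNgt prednK ?size_poly_gt0 // sq.
have leD : (ex_minn exJ < size p)%N.
  by rewrite ltnNge; apply/negP => /(Jmin 0%N _ Pp)/eqP; rewrite (negPf p0).
case: ex_minnP leD Jmin => D /asboolP[q [sq mq Pq]] _ leD /(_ 0%N) Jmin.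
have lq : q`_D = 1 by move/monicP: mq; rewrite lead_coefE sq.
have q_type j l : q`_j * (iter j sigma l - iter D sigma l) = 0.
  pose r := skewM q l%:P - iter D sigma l *: q.
  have er i : r`_i = q`_i * (iter i sigma l - iter D sigma l).
    by rewrite coefB coefZ coef_skew_mulC mulrBr [X in _ - X]mulrC.
  rewrite -er; suff -> : r = 0 by rewrite coef0.
  apply: Jmin; first by rewrite raddfB /= qpiM qpiZ rmorphB !rmorphM Pq mulr0
    mul0r subrr.
  apply/leq_sizeP => i; rewrite leq_eqVlt er => /orP[/eqP<-|Di];
    first by rewrite subrr mulr0.
  by rewrite nth_default ?mul0r // sq.
have PhiX i y : Phi (y * qX F ^+ i) = 0 -> Phi y = 0.
  have xi : qX F ^+ i * x' ^+ i = 1.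
    elim: i => [|i IH]; first by rewrite !expr0 mulr1.
    by rewrite exprSr exprS -mulrA [X in _ * X]mulrA xx' mul1r.
  move=> e; rewrite -[y]mulr1 -xi mulrA rmorphM e mul0r //.
have q_fix j : exists c : K, q`_j = c%:A.
  apply: (sigma_fixed sigma_gen).
  case: (ltngtP j D) => [jD|Dj|->]; last by rewrite lq rmorph1.
    pose r := \poly_(i < D) (sigma q`_i - q`_i).
    have er : skewM 'X q - q * 'X = r * 'X.
      rewrite -{1}(expr1 'X) skew_mulXnl expr1 -mulrBl; congr (_ * _).
      apply/polyP => i; rewrite coefB coef_map coef_poly /=.
      case: (ltngtP i D) => // [Di|->]; last by rewrite lq rmorph1 subrr.
      by rewrite !nth_default ?sq // rmorph0 subrr.
    have : r = 0.
      apply: Jmin; last exact: size_poly.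
      apply: (PhiX 1%N); rewrite -qpiXn -qpiM skew_mul_Xn expr1 -er.
      rewrite -{2}(expr1 'X) -(skew_mul_Xn sigma) raddfB /= !qpiM rmorphB
        !rmorphM Pq.
      by rewrite mulr0 mul0r subrr.
    move/polyP/(_ j); rewrite coef_poly jD coef0 => /eqP; rewrite subr_eq0.
    by move/eqP.
  by rewrite nth_default ?sq // rmorph0.
have [c ec] := boolp.choice q_fix.
have q_mod i : q`_i != 0 -> i = D %[mod n].
  move=> qi; apply: (iter_sigma_eq sigma_gen) => l.
  by have /eqP := q_type i l; rewrite mulf_eq0 (negPf qi) subr_eq0 => /eqP.
pose e := (D %% n)%N.
(* The first [s] coefficients capture all of q, whose degree is below s n; they also force deg h <
   deg F, whence the coprimality below. *)
pose h := \poly_(t < s) c (e + n * t)%N.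
have n0 := dimL_gt0 L.
have eq : q = comp_Xn L h * 'X^e.
  apply/polyP => i; rewrite coefMXn; case: ltnP => ie.
    apply/eqP/negPn/negP => /q_mod im.
    by move: ie; rewrite /e -im ltnNge leq_mod.
  rewrite coef_comp_Xn; case: ifP => [/dvdnP[t et]|nd].
    have ei : i = (e + n * t)%N by rewrite mulnC -et subnKC.
    rewrite et mulnK // coef_poly; case: ltnP => ts; first by rewrite -ec -ei.
    rewrite scale0r nth_default // sq (leq_trans leD) // (leq_trans sp) //.
    by rewrite ei mulnC (leq_trans _ (leq_addl _ _)) // leq_mul2l ts orbT.
  apply/eqP/negPn/negP => /q_mod im; move/negP: nd; apply.
  by rewrite -eqn_mod_dvd // im modn_mod.
have Ph : Phi (qpi F (comp_Xn L h)) = 0.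
  by apply: (PhiX e); rewrite -qpiXn -qpiM skew_mul_Xn -eq.
have h0 : h != 0.
  by apply/eqP => h0; move: lq; rewrite eq h0 rmorph0 mul0r coef0 => /eqP;
    rewrite eq_sym oner_eq0.
have /Bezout_eq1_coprimepP[[u v] /= uv] : coprimep F h.
  apply/negPn/negP => gF; have := iF.2 _ gF (dvdp_gcdl F h).
  move=> /eqp_dvdl e'; have := dvdp_gcdr F h; rewrite e' => /(dvdp_leq h0).
  by rewrite sF leqNgt ltnS size_poly.
have : Phi (qpi F (comp_Xn L (u * F + v * h))) = 0.
  have -> : comp_Xn L (u * F + v * h) = skewM (comp_Xn L u) (comp_Xn L F) +
      skewM (comp_Xn L v) (comp_Xn L h).
    by rewrite !skew_mul_comp_Xn rmorphD !rmorphM.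
  rewrite raddfD /= !qpiM rmorphD !rmorphM Ph.
  by rewrite qpi_comp_Xn rmorph0 !mulr0 addr0.
by rewrite uv rmorph1 rmorph1 => /eqP; rewrite (negPf A1).
Qed.
End Irreducible.

(** * The isomorphism of the quotient with n by n matrices over E *)

Section MatrixIso.

Variables (K : finFieldType) (L : splittingFieldType K) (sigma : gal_of {:L}).
Hypothesis sigma_gen : generator 'Gal({:L} / 1)%g sigma.
Local Notation n := (\dim {:L}).

Lemma card_finvect (V : fieldExtType K) : #|finvect_type V| = (#|K| ^ \dim {:V})%N.
Proof.
rewrite -(@card_vspace K _ _ {:finvect_type V}%VS).
by apply: eq_card => x; rewrite memvf.
Qed.

(** F has a root in a field with q^s elements, all of which are roots of X^(q^s) - X. The two
    polynomials thus share a root, and F is irreducible. *)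
Lemma irreducible_dvd_Xq s (F : {poly K}) : size F = s.+1 -> irreducible_poly F ->
  F %| 'X^(#|K| ^ s) - 'X.
Proof.
move=> sF iF; have [M dM [z rz _]] := irredp_FAdjoin iF.
have zq : z ^+ (#|K| ^ s) = z.
  apply/eqP; have := Fermat's_little_theorem {:M}%AS z.
  by rewrite memvf dM sF => <-.
have [gF|gF] := eqVneq (size (gcdp F ('X^(#|K| ^ s) - 'X))) 1%N.
  have : coprimep (map_poly (in_alg M) F) (map_poly (in_alg M) ('X^(#|K| ^ s) -
    'X)).
    by rewrite coprimep_map /coprimep gF.
  move/coprimep_root/(_ rz); rewrite rmorphB /= map_polyXn map_polyX.
  by rewrite !hornerE zq subrr eqxx.
have /eqp_dvdl e' := iF.2 _ gF (dvdp_gcdl _ _).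
by rewrite -e' dvdp_gcdr.
Qed.

(** X^(q^s) - X is the product of all X - x with x in E, so its divisor F is, up to a constant, a
    product of such factors, nonempty because s > 0. *)
Lemma irreducible_root (E : finFieldType) (j : {rmorphism K -> E}) s (F : {poly
  K}) :
    #|E| = (#|K| ^ s)%N -> (0 < s)%N -> size F = s.+1 -> irreducible_poly F ->
  exists y, root (map_poly j F) y.
Proof.
move=> cE s0 sF iF.
have : map_poly j F %| \prod_(x <- enum E) ('X - x%:P).
  rewrite big_enum /= -finField_genPoly cE.
  have := irreducible_dvd_Xq sF iF; rewrite -(dvdp_map j).
  by rewrite rmorphB /= map_polyXn map_polyX.
case/dvdp_prod_XsubC => m e'.
move: (e'); case: (mask m (enum E)) => [|y ys] {}e'.
  have := eqp_size e'; rewrite big_nil size_poly1 size_map_poly sF => -[] s00.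
  by rewrite s00 in s0.
by exists y; rewrite (eqp_root e') root_prod_XsubC inE eqxx.
Qed.

Variables (E : fieldExtType K) (s : nat) (F : {poly K}).
Hypotheses (s_gt1 : (1 < s)%N) (irrF : irr_poly_pred s F).
Hypothesis dim_E : \dim {:E} = s.

Lemma qscalE c : skew_pi sigma F c%:A = qscal sigma F c.
Proof.
by rewrite /qscal /qpi; congr (skew_pi _ _ _); apply: val_inj; rewrite /= alg_polyC.
Qed.

(** Take a root [y] of F in E, nonzero because F(0) is. A matrix [x] as in [skew_matrices] satisfies
    F(x^n) = F(y) = 0, which yields a morphism out of the quotient. *)
Lemma skew_quot_matrix_iso :
  exists psi : {rmorphism skew_quot sigma F -> 'M[E]_n}, is_alg_iso psi.
Proof.
have /and3P[_ /eqP sF /irreducibleP iF] := irrF.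
pose E' : finFieldType := finvect_type E.
have cE : #|E'| = (#|K| ^ s)%N by rewrite card_finvect dim_E.
pose j : {rmorphism K -> E'} := in_alg E.
have [y ry] := irreducible_root j cE (ltnW s_gt1) sF iF.
have y0 : y != 0.
  apply: contraTneq ry => ->; rewrite /root horner_coef0 coef_map fmorph_eq0.
  exact: irr_coef0 irrF.
have [f [x [fK fx xn]]] := skew_matrices sigma_gen j cE y0 (ltnW s_gt1).
have Fx : \sum_(i < size F) f (F`_i)%:A * x ^+ (n * i) = 0.
  transitivity (((map_poly j F).[y])%:M : 'M[E']_n);
    last by rewrite (eqP ry) raddf0.
  rewrite horner_coef size_map_poly raddf_sum; apply: eq_bigr => i _ /=.
  by rewrite fK exprM xn coef_map -rmorphXn -rmorphM.
have [psi psiE] := skew_quot_hom fx Fx.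
have one_neq0 : 1 != 0 :> 'M[E']_n.
  apply/eqP => /matrixP/(_ (Ordinal (dimL_gt0 L)) (Ordinal (dimL_gt0 L))).
  by rewrite !mxE eqxx => /eqP; rewrite oner_eq0.
have psi_inj := skew_quot_hom_inj sigma_gen s_gt1 irrF one_neq0 (Phi := psi).
exists psi; split; last first.
  by move=> c; rewrite qscalE psiE -alg_polyC skew_evalZ -(expr0 'X)
    skew_evalXn expr0 mulr1 fK.
pose L' : finFieldType := finvect_type L.
(* [v] lists the coefficients of a reduced representative; vectors and matrices both number q^(s
   n^2), so the injective [g] is onto. *)
pose g (v : 'rV[L']_(s * n)) : 'M[E']_n := psi (qpi sigma F (rVpoly v)).
have g_inj : injective g.
  move=> v w /psi_inj/(qpi_inj irrF) e; apply: (can_inj (@rVpolyK _ _)).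
  by apply: e; exact: size_poly.
have /(inj_card_bij g_inj)[g' gK Kg] : (#|'M[E']_n| <= #|'rV[L']_(s * n)|)%N.
  rewrite !card_mx cE card_finvect -!expnM mul1n leq_eqVlt; apply/orP; left.
  by apply/eqP; congr (_ ^ _)%N; rewrite mulnCA mulnA.
exists (fun A => qpi sigma F (rVpoly (g' A))) => [u|A]; last exact: Kg.
by apply: psi_inj; rewrite -/(g _) Kg.
Qed.

End MatrixIso.

(** * Degrees and homogeneous elements *)
Section Degree.

Variables (K : finFieldType) (L : splittingFieldType K) (sigma : gal_of {:L}).
Hypothesis sigma_gen : generator 'Gal({:L} / 1)%g sigma.
Local Notation n := (\dim {:L}).
Local Notation skewM := (skew_mul (gal_repr sigma)).

Variables (s m : nat) (G : {poly K}).
Hypotheses (s_gt1 : (1 < s)%N) (irrG : irr_poly_pred s G).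
Local Notation RG := (skew_quot sigma G).
Local Notation qpi := (qpi sigma G).
Local Notation qscal := (qscal sigma G).
Local Notation qX := (qX sigma G).

(** For m = s k this is membership in the code. *)
Definition low_degree (y : RG) : Prop :=
  exists2 p : {poly L}, (size p <= m)%N & y = qpi p.

(* Homogeneity of degree e for the Z/n-grading by powers of X. *)
Definition has_type (e : nat) (y : RG) : Prop :=
  forall l, y * qscal l = qscal (iter e sigma l) * y.

Lemma qscal_inj : injective qscal.
Proof.
have h (l : L) : (size l%:P <= s * n)%N.
  rewrite (leq_trans (size_polyC_leq1 l)) // muln_gt0 dimL_gt0 andbT.
  exact: ltnW.
by move=> l l' /(qpi_inj irrG (h l) (h l')) /polyC_inj.
Qed.

Lemma low_degree_qpi (p : {poly L}) : (m <= s * n)%N -> (size p <= s * n)%N ->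
  low_degree (qpi p) -> (size p <= m)%N.
Proof.
move=> msn sp [q sq]; move/(qpi_inj irrG sp (leq_trans sq msn)) => ->.
exact: sq.
Qed.

Lemma low_degreeXn i : (i < m)%N -> low_degree (qX ^+ i).
Proof. by move=> im; exists 'X^i; rewrite ?size_polyXn ?qpiXn. Qed.

Lemma size_map_iter i (p : {poly L}) : size (map_poly (iter i sigma) p) = size p.
Proof. exact: (size_map_poly (iter i (gal_repr sigma))). Qed.

Section Idealizers.
Hypothesis m_range : (0 < m < s * n)%N.

(** As 1 has low degree, [a] is the class of some p of size at most m. If p is not constant, p X^(m
    - deg p) has degree exactly m, and it is still reduced since m < s n: a contradiction. *)
Lemma left_idealizer a : (forall y, low_degree y -> low_degree (a * y)) ->
  exists l, a = qscal l.
Proof.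
have /andP[m0 msn] := m_range; move=> aD.
have [p sp ea] : low_degree a by rewrite -[a]mulr1 -(expr0 qX);
  apply/aD/low_degreeXn.
have [sp1|sp1] := leqP (size p) 1; first by exists p`_0;
  rewrite ea /qscal -size1_polyC.
have := aD _ (low_degreeXn (_ : m - (size p).-1 < m)%N).
rewrite ea -qpiXn -qpiM skew_mul_Xn => h.
have p0 : p != 0 by rewrite -size_poly_gt0 ltnW.
have /low_degree_qpi : low_degree (qpi (p * 'X^(m - (size p).-1))) by apply: h; lia.
rewrite size_mulXn // (_ : _ + _ = m.+1)%N; last by lia.
by rewrite ltnn => /(_ (ltnW msn) msn).
Qed.

Lemma right_idealizer a : (forall y, low_degree y -> low_degree (y * a)) ->
  exists l, a = qscal l.
Proof.
have /andP[m0 msn] := m_range; move=> aD.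
have [p sp ea] : low_degree a by rewrite -[a]mul1r -(expr0 qX);
  apply/aD/low_degreeXn.
have [sp1|sp1] := leqP (size p) 1; first by exists p`_0;
  rewrite ea /qscal -size1_polyC.
set j := (m - (size p).-1)%N.
have := aD _ (low_degreeXn (_ : j < m)%N).
rewrite ea -qpiXn -qpiM skew_mulXnl => h.
have p0 : map_poly (iter j sigma) p != 0.
  by rewrite -size_poly_gt0 size_map_iter ltnW.
have /low_degree_qpi : low_degree (qpi (map_poly (iter j sigma) p * 'X^j)).
  by apply: h; rewrite /j; lia.
rewrite size_mulXn // size_map_iter (_ : _ + _ = m.+1)%N; last by rewrite /j; lia.
by rewrite ltnn => /(_ (ltnW msn) msn).
Qed.

End Idealizers.

Lemma has_typeXn i : has_type i (qX ^+ i).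
Proof. by move=> l; rewrite qX_scal. Qed.

(** The representatives of y l and sigma^e(l) y are both reduced, so their coefficients agree; a
    nonzero one at X^j gives sigma^j = sigma^e on L. *)
Lemma has_type_coef e (p : {poly L}) : (size p <= s * n)%N -> has_type e (qpi p) ->
  forall j, p`_j != 0 -> j = e %[mod n].
Proof.
move=> sp tp j pj; apply: (iter_sigma_eq sigma_gen) => l.
have := tp l; rewrite -qpiZ -qpiM => /(qpi_inj irrG).
have sl : (size (skewM p l%:P) <= s * n)%N.
  apply/leq_sizeP => i hi; rewrite coef_skew_mulC nth_default ?mul0r //.
  exact: leq_trans hi.
move/(_ sl (leq_trans (size_scale_leq _ _) sp)) => /polyP/(_ j).
by rewrite coef_skew_mulC coefZ [RHS]mulrC => /(mulfI pj).
Qed.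

Lemma has_typeM e f y z : has_type e y -> has_type f z -> has_type (e + f) (y * z).
Proof.
by move=> ty tz l; rewrite -mulrA tz mulrA ty -mulrA iterD.
Qed.

Hypothesis m_bound : (1 < m)%N /\ (m + 1 < s * n)%N.
Variables (u : RG) (g : {poly L}) (e0 : nat).
Hypotheses (sg : (size g <= s * n)%N) (ug : u = qpi g) (g_neq0 : g != 0).
Hypothesis u_type : has_type 1 u.
Hypothesis u_shift : forall e y, e <> e0 %[mod n] -> has_type e y ->
  low_degree y -> low_degree (y * u).

(** X^v is homogeneous of low degree, and X^v u is represented by a polynomial of degree v + deg g,
    reduced by the last hypothesis. *)
Lemma degree_shift v : (v < m)%N -> v <> e0 %[mod n] ->
  (v + (size g).-1 < s * n)%N -> (v + (size g).-1 < m)%N.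
Proof.
move=> vm ve vg; have [_ m_sn] := m_bound.
have g0 : (0 < size g)%N by rewrite size_poly_gt0.
have sg' : size (map_poly (iter v sigma) g * 'X^v) = (v + (size g).-1).+1.
  rewrite size_mulXn ?size_map_iter; first by rewrite -addnS prednK.
  by rewrite -size_poly_gt0 size_map_iter.
have := u_shift ve (has_typeXn v) (low_degreeXn vm).
rewrite ug -qpiXn -qpiM skew_mulXnl => /low_degree_qpi.
by rewrite sg' => ->//; lia.
Qed.

Lemma degree_alternative : (1 < n)%N ->
  (exists2 a, a != 0 & u = qscal a * qX) \/ (n = 2%N /\ size g = (s * n)%N).
Proof.
move=> n1; have [m1 m_sn] := m_bound.
have g0 : (0 < size g)%N by rewrite size_poly_gt0.
have tg : has_type 1 (qpi g) by rewrite -ug.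
have gtype := has_type_coef sg tg.
have Dmod : (size g).-1 = 1 %[mod n].
  by apply: gtype; rewrite -lead_coefE lead_coef_eq0.
have [sg2|sg2] := leqP (size g) 2.
  left; exists g`_1.
    apply/eqP => g10; have eg : g = (g`_0)%:P.
      apply/polyP => -[|[|i]]; rewrite coefC //=.
      by rewrite nth_default // (leq_trans sg2).
    have g00 : g`_0 != 0 by apply: contra_neq g_neq0 => g00; rewrite eg g00.
    by have := gtype _ g00; rewrite mod0n modn_small.
  rewrite ug (qpiE _ _ sg2) !big_ord_recl big_ord0 /= addr0.
  have [->|/gtype] := eqVneq g`_0 0; last by rewrite mod0n modn_small.
  by rewrite rmorph0 mul0r add0r expr1.
right; set D := (size g).-1 in Dmod.
have D2 : (2 <= D)%N by rewrite /D; lia.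
(* First case: D = s n - 1, and D = 1 modulo n gives n | 2. *)
have [sgD|sgD] := leqP (s * n)%N (D + 1).
  have eD : size g = (s * n)%N.
    by apply/eqP; rewrite eqn_leq sg; move: sgD; rewrite /D addn1 prednK.
  split=> //; have : (n %| 2)%N.
    have : (D + 1 = 0 %[mod n])%N by rewrite /D eD addn1 prednK ?modnMl ?mod0n
      // -eD.
    rewrite -modnDml Dmod modnDml mod0n => /eqP.
    by rewrite addn1.
  by move/dvdn_leq => /(_ isT); lia.
have no v : (v < m)%N -> (v + D < s * n)%N -> (m <= v + D)%N -> v = e0 %[mod n].
  move=> vm vD mv; have [//|/eqP ve] := eqVneq (v %% n)%N (e0 %% n)%N.
  by have := degree_shift vm ve vD; rewrite ltnNge mv.
(* The subtraction is truncated: the exponent is 0 when D >= m. In either case it and its successor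
   are below m, while adding D puts both in the range from m to s n - 1. Two consecutive exponents
   cannot both be congruent to [e0] as n > 1. *)
have e1 : (m - D = e0 %[mod n])%N by apply: no; lia.
have e2 : ((m - D) + 1 = e0 %[mod n])%N by apply: no; lia.
have : (m - D + 1 = m - D + 0 %[mod n])%N by rewrite addn0 e2 e1.
by move=> /eqP; rewrite eqn_modDl mod0n modn_small.
Qed.

End Degree.

(** * The case n = 2, where X may go to a multiple of its inverse *)

Section Quadratic.

Variables (K : finFieldType) (L : splittingFieldType K) (sigma : gal_of {:L}).
Hypothesis sigma_gen : generator 'Gal({:L} / 1)%g sigma.
Local Notation n := (\dim {:L}).
Local Notation skewM := (skew_mul (gal_repr sigma)).

Variables (s : nat) (G : {poly K}).
Hypotheses (s_gt1 : (1 < s)%N) (irrG : irr_poly_pred s G).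
Local Notation RG := (skew_quot sigma G).
Local Notation qpi := (qpi sigma G).
Local Notation qscal := (qscal sigma G).
Local Notation qX := (qX sigma G).
Hypothesis n2 : n = 2%N.

(** When u has degree 2 s - 1, 1 u = u is not of low degree, so [e0] is even and odd exponents are
    available. Writing X^(v+1) u = X^v (X u) for even v then restricts the degree of X u, which is
    even. *)
Lemma degree_trichotomy (u : RG) (e0 : nat) : u != 0 -> has_type 1 u ->
    (forall e y, e <> e0 %[mod n] -> has_type e y ->
      low_degree s y -> low_degree s (y * u)) ->
  [\/ exists2 a, a != 0 & u = qscal a * qX,
      exists b, qX * u = qscal b |
      exists p : {poly L}, [/\ (3 <= s)%N, size p = 3%N & qX * u = qpi p]].
Proof.
move=> u0 tu us; pose g := qrep u.
have sg : (size g <= s * n)%N by exact: size_qrep.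
have ug : u = qpi g by rewrite qrepK.
have g0 : g != 0 by apply: contra_neq u0 => e; rewrite ug e raddf0.
have mb : (1 < s)%N /\ (s + 1 < s * n)%N by rewrite n2; lia.
have n1 : (1 < n)%N by rewrite n2.
have [h|[_ sgE]] := degree_alternative sigma_gen s_gt1 irrG mb sg ug g0 tu us n1.
  by constructor 1.
have e00 : e0 = 0 %[mod n].
  apply/eqP; apply/negPn/negP => /eqP e00.
  have := degree_shift sigma_gen s_gt1 irrG mb sg ug g0 us (v := 0%N) (ltnW s_gt1).
  by rewrite n2 in e00; rewrite sgE n2 => /(_ (fun h => e00 (esym h))); lia.
pose p := qrep (qX * u).
have sp : (size p <= s * n)%N by exact: size_qrep.
have Xu : qX * u = qpi p by rewrite qrepK.
have tp : has_type 2 (qpi p).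
  by rewrite -Xu; have := has_typeM (has_typeXn sigma G 1) tu; rewrite expr1.
have ptype j : p`_j != 0 -> (j %% 2 = 0)%N.
  by move/(has_type_coef sigma_gen irrG sp tp); rewrite n2.
have [sp1|sp1] := leqP (size p) 1.
  by constructor 2; exists p`_0; rewrite Xu /qscal -size1_polyC.
have p0 : p != 0 by rewrite -size_poly_gt0 ltnW.
have pD : ((size p).-1 %% 2 = 0)%N by apply: ptype;
  rewrite -lead_coefE lead_coef_eq0.
have shift v : (v %% 2 = 0)%N -> (v.+1 < s)%N ->
    (v + (size p).-1 < s * 2)%N -> (v + (size p).-1 < s)%N.
  move=> v2 vs vp.
  have ve : v.+1 <> e0 %[mod n] by rewrite e00 n2; lia.
  have := us _ _ ve (has_typeXn sigma G v.+1) (low_degreeXn sigma G vs).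
  rewrite exprSr -mulrA Xu -qpiXn -qpiM skew_mulXnl.
  have sz : size (map_poly (iter v sigma) p * 'X^v) = (v + (size p).-1).+1.
    rewrite size_mulXn ?size_map_iter; first by rewrite -addnS prednK // ltnW.
    by rewrite -size_poly_gt0 size_map_iter ltnW.
  by move/(low_degree_qpi irrG); rewrite sz n2; apply; lia.
constructor 3; exists p; split=> //.
  have s3 : (2 < s)%N \/ s = 2%N by lia.
  case: s3 => // s2; have := shift 0%N erefl; rewrite add0n s2.
  by rewrite n2 s2 in sp; lia.
have [//|sp3] := eqVneq (size p) 3%N.
rewrite n2 in sp.
have [ge|lt] := leqP s (size p).-1.
  have := shift 0%N erefl s_gt1; rewrite add0n; lia.
(* This exponent is even and raises the degree to s or s + 1, out of the low range; it is small
   enough because deg p is now even and at least 4. *)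
have := shift (s - (size p).-1 + (s %% 2))%N; lia.
Qed.

(** If X u is quadratic, the trichotomy is applied to the inverse [u']: its first two cases
    determine [u], the third is contradictory. *)
Lemma inverse_pair_quadratic (u u' : RG) (e0 e1 : nat) :
    u * u' = 1 -> u' * u = 1 -> has_type 1 u -> has_type 1 u' ->
    (forall e y, e <> e0 %[mod n] -> has_type e y ->
      low_degree s y -> low_degree s (y * u)) ->
    (forall e y, e <> e1 %[mod n] -> has_type e y ->
      low_degree s y -> low_degree s (y * u')) ->
  (exists2 a, a != 0 & u = qscal a * qX) \/ (exists2 b, b != 0 & qX * u = qscal b).
Proof.
move=> uu' u'u tu tu' us us'.
have one0 : 1 != 0 :> RG.
  rewrite -(rmorph1 qscal) -(rmorph0 qscal) (inj_eq (qscal_inj s_gt1 irrG)).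
  exact: oner_neq0.
have u0 : u != 0 by apply: contraNneq one0 => u0; rewrite -uu' u0 mul0r.
have u'0 : u' != 0 by apply: contraNneq one0 => u'0; rewrite -u'u u'0 mul0r.
have [x' x'x xx'] := qX_unit sigma s_gt1 irrG.
have Xu0 b (v v' : RG) : v * v' = 1 -> qX * v = qscal b -> b != 0.
  move=> vv' e; apply: contraNneq one0 => b0; apply/eqP.
  have -> : 1 = x' * (qX * v) * v' by rewrite -!mulrA vv' mulr1 x'x.
  by rewrite e b0 rmorph0 mulr0 mul0r.
case: (degree_trichotomy u0 tu us) => [|[b eb]|[p [s3 sp ep]]]; first by left.
  by right; exists b => //; exact: Xu0 uu' eb.
case: (degree_trichotomy u'0 tu' us') => [[a a0 ea]|[b eb]|[p' [_ sp' ep']]].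
- right; exists a^-1; rewrite ?invr_eq0 //.
  rewrite -[LHS]mul1r -(rmorph1 qscal) -(mulVf a0) rmorphM -mulrA.
  by rewrite [qscal a * _]mulrA -ea u'u mulr1.
- left; have b0 := Xu0 _ _ _ u'u eb; exists b^-1; rewrite ?invr_eq0 //.
  have -> : qX = qscal b * u by rewrite -eb -mulrA u'u mulr1.
  by rewrite mulrA -rmorphM mulVf // rmorph1 mul1r.
(* X^2 = p^sigma p' with both factors of degree 2, and 4 < 2s: compare X^4. *)
exfalso; pose sp1 := map_poly (iter 1 sigma) p.
have e1' : qX * qpi p = qpi sp1 * qX.
  by rewrite -[qX]expr1 -qpiXn -!qpiM skew_mulXnl skew_mul_Xn.
have ePP : qpi p * x' * qpi p' = qX.
  rewrite -ep -ep' mulrA -[_ * x' * qX]mulrA x'x mulr1.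
  by rewrite -mulrA uu' mulr1.
have : qpi 'X^2 = qpi (skewM sp1 p').
  by rewrite qpiXn expr2 -{2}ePP !mulrA e1' -[_ * x']mulrA xx' mulr1 qpiM.
have sq : size sp1 = 3%N by rewrite size_map_iter.
have eM : skewM sp1 p' = sp1`_0 *: p' + sp1`_1 *: (map_poly sigma p' * 'X)
    + sp1`_2 *: (map_poly (iter 2 sigma) p' * 'X^2).
  rewrite (@skew_mul_widen _ _ 3) ?sq // !big_ord_recl big_ord0 /= addr0 addrA.
  by rewrite expr0 mulr1 expr1 map_poly_id.
have sM : (size (skewM sp1 p') <= 5)%N.
  rewrite eM; apply: (leq_trans (size_polyD _ _)); rewrite geq_max; apply/andP;
    split.
    apply: (leq_trans (size_polyD _ _)); rewrite geq_max; apply/andP; split;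
    apply: (leq_trans (size_scale_leq _ _)); rewrite ?sp' //;
    apply: (leq_trans (size_polyMleq _ _)).
    by rewrite size_map_poly sp' size_polyX.
  apply: (leq_trans (size_scale_leq _ _)); apply: (leq_trans (size_polyMleq _ _)).
  by rewrite size_map_iter sp' size_polyXn.
have sn5 : (5 <= s * n)%N by rewrite n2; clear -s3; lia.
have s2 : (size ('X^2 : {poly L}) <= s * n)%N.
  by rewrite size_polyXn (leq_trans _ sn5).
move/(qpi_inj irrG s2 (leq_trans sM sn5)).
move/polyP/(_ 4%N); rewrite eM coefXn !coefD !coefZ coefMX coefMXn /=.
have p3 : p'`_3 = 0 by rewrite nth_default ?sp'.
have p4 : p'`_4 = 0 by rewrite nth_default ?sp'.
have c3 : (map_poly sigma p')`_3 = 0 by rewrite coef_map_id0 ?p3 rmorph0.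
have c4 : (map_poly (iter 2 sigma) p')`_(4 - 2) = sigma (sigma p'`_2).
  by rewrite coef_map_id0 //= !rmorph0.
have c2 : sp1`_2 = sigma p`_2 by rewrite coef_map_id0 //= rmorph0.
clearbody sp1; move=> e; have : sigma p`_2 * sigma (sigma p'`_2) == 0.
  apply/eqP; symmetry; apply: (etrans e); rewrite p4 mulr0 add0r.
  apply: (etrans (congr2 +%R (congr1 ( *%R _) c3) (congr2 *%R c2 c4))).
  by rewrite mulr0 add0r.
rewrite mulf_eq0 !fmorph_eq0.
suff lead2 (q : {poly L}) : size q = 3%N -> q`_2 != 0.
  by rewrite (negPf (lead2 p sp)) (negPf (lead2 p' sp')).
by move=> sq3; have := lead_coef_eq0 q;
  rewrite lead_coefE sq3 -size_poly_eq0 sq3 => ->.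
Qed.

End Quadratic.

(** * Equivalent codes come from twisted polynomials *)
Section FieldEndomorphisms.

Variables (K : finFieldType) (L : splittingFieldType K) (sigma : gal_of {:L}).
Hypothesis sigma_gen : generator 'Gal({:L} / 1)%g sigma.
Local Notation n := (\dim {:L}).
Variables (p r : nat).
Hypotheses (p_prime : prime p) (r_gt0 : (0 < r)%N) (card_K : #|K| = (p ^ r)%N).

Lemma rmorph_frobenius_ext (V : fieldExtType K) (t : {rmorphism V -> V}) :
  exists b, forall x, t x = x ^+ (p ^ b).
Proof.
have cV : #|finvect_type V| = (p ^ (r * \dim {:V}))%N.
  by rewrite card_finvect card_K expnM.
have pV : p \in [pchar (finvect_type V : finFieldType)] := card_finPcharP cV
  p_prime.
have V0 : (0 < r * \dim {:V})%N by rewrite muln_gt0 r_gt0 adim_gt0.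
have [b _ eb] := rmorph_frobenius (t : {rmorphism finvect_type V ->
  finvect_type V}) pV cV V0.
by exists b.
Qed.

(** [t] is a power map, and power maps commute with ring morphisms. *)
Lemma rmorph_sigma (t : {rmorphism L -> L}) e x :
  t (iter e sigma x) = iter e sigma (t x).
Proof.
have [b eb] := rmorph_frobenius_ext t.
by rewrite !eb iter_sigma rmorphXn -iter_sigma.
Qed.

Lemma rmorph_iter_id (t : {rmorphism L -> L}) : exists2 N, (0 < N)%N &
  forall x, iter N t x = x.
Proof.
have [b eb] := rmorph_frobenius_ext t.
exists (r * n)%N => [|x]; first by rewrite muln_gt0 r_gt0 adim_gt0.
have eN N y : iter N t y = y ^+ (p ^ (b * N)).
  elim: N => [|N IH] /=; first by rewrite muln0 expr1.
  by rewrite IH eb -exprM -expnD mulnS addnC.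
rewrite eN mulnC expnM -expnM expnM; elim: b {eb eN} => [|b IH] /=.
  by rewrite expn0 expr1.
rewrite expnS exprM.
have -> : (p ^ (r * n))%N = (#|K| ^ n)%N by rewrite card_K expnM.
by rewrite expr_card_ext -[RHS]IH card_K expnM.
Qed.

(** z t^-1 fixes K, hence is a power of [sigma]; t^-1 is an iterate of [t], which has finite
    order. *)
Lemma rmorph_twist (t z : {rmorphism L -> L}) (h : K -> K) :
    (forall c : K, t c%:A = (h c)%:A) -> (forall c : K, z c%:A = (h c)%:A) ->
  exists i, forall x, z x = iter i sigma (t x).
Proof.
move=> tK zK; have [N N0 tN] := rmorph_iter_id t.
pose t' : {rmorphism L -> L} := iter N.-1 t.
have tt' x : t (t' x) = x by rewrite -[RHS]tN -[in RHS](prednK N0).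
have t't x : t' (t x) = x by rewrite -[RHS]tN -[in RHS](prednK N0) iterSr.
have tKi i (c : K) : iter i t c%:A = (iter i h c)%:A.
  by elim: i => //= i ->.
pose zt : {rmorphism L -> L} := z \o t'.
have [c|i ei] := rmorph_gal sigma_gen (z := zt).
  by rewrite /= tKi zK -tK -tKi tt'.
by exists i => x; rewrite -ei /= t't.
Qed.

Lemma rmorph_surj (t : {rmorphism L -> L}) y : exists x, t x = y.
Proof.
have [N N0 tN] := rmorph_iter_id t.
by exists (iter N.-1 t y); rewrite -iterS prednK.
Qed.

End FieldEndomorphisms.

(** * Constraints on [theta] and [w], and the resulting relation between F and G *)

Section OnlyIf.

Variables (K : finFieldType) (L : splittingFieldType K) (sigma : gal_of {:L}).
Hypothesis sigma_gen : generator 'Gal({:L} / 1)%g sigma.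
Local Notation n := (\dim {:L}).
Local Notation skewM := (skew_mul (gal_repr sigma)).
Variables (p r : nat).
Hypotheses (p_prime : prime p) (r_gt0 : (0 < r)%N) (card_K : #|K| = (p ^ r)%N).
Variables (s k : nat) (F G : {poly K}).
Hypotheses (s_gt1 : (1 < s)%N) (n_gt1 : (1 < n)%N) (k_range : (1 <= k <= n - 1)%N).
Hypotheses (irrF : irr_poly_pred s F) (irrG : irr_poly_pred s G).

Variable theta : {rmorphism skew_quot sigma F -> skew_quot sigma G}.
Variables (w w' : skew_quot sigma G) (h : K -> K).
Hypotheses (ww' : w * w' = 1) (w'w : w' * w = 1).
Hypothesis theta_K : forall c, theta (qscal sigma F c%:A) = qscal sigma G (h c)%:A.
Hypothesis theta_code : forall y,
  low_degree (s * k) y <-> exists2 x, low_degree (s * k) x & y = w * theta x.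

Local Notation m := (s * k)%N.

Lemma m_range : (0 < m < s * n)%N.
Proof. by rewrite muln_gt0 ltn_pmul2l; lia. Qed.

Lemma m_bound : (1 < m)%N /\ (m + 1 < s * n)%N.
Proof.
have [k' ek] : exists k', k = k'.+1 by exists k.-1; lia.
have [d ed] : exists d, n = (k + d.+1)%N by exists (n - k.+1)%N; lia.
rewrite ed ek !(mulnS, mulnDr); split; lia.
Qed.

Lemma skew_one_neq0 (H : {poly K}) : irr_poly_pred s H -> 1 != 0 :> skew_quot
  sigma H.
Proof.
move=> irrH; rewrite -(rmorph1 (qscal sigma H)) -(rmorph0 (qscal sigma H)).
by rewrite (inj_eq (qscal_inj s_gt1 irrH)) oner_neq0.
Qed.

Lemma theta_inj : injective theta.
Proof. exact: (skew_quot_hom_inj sigma_gen s_gt1 irrF (skew_one_neq0 irrG)). Qed.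

Lemma low_degree_scall (H : {poly K}) l (y : skew_quot sigma H) :
  low_degree m y -> low_degree m (qscal sigma H l * y).
Proof.
case=> q sq ->; exists (l *: q); last by rewrite qpiZ.
by rewrite (leq_trans (size_scale_leq _ _)).
Qed.

Lemma low_degree_scalr (H : {poly K}) l (y : skew_quot sigma H) :
  low_degree m y -> low_degree m (y * qscal sigma H l).
Proof.
case=> q sq ->; exists (skewM q l%:P); last by rewrite qpiM.
apply/leq_sizeP => i hi; rewrite coef_skew_mulC nth_default ?mul0r //.
exact: leq_trans hi.
Qed.

Lemma rmorph_of_qscal (f : {rmorphism L -> skew_quot sigma G}) :
    (forall l, exists l', f l = qscal sigma G l') ->
  exists t : {rmorphism L -> L}, forall l, f l = qscal sigma G (t l).
Proof.
move=> /boolp.choice[t et]; have inj := @qscal_inj _ _ sigma s G s_gt1 irrG.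
have tB : zmod_morphism t by move=> x y; apply: inj;
  rewrite -et rmorphB [RHS]rmorphB !et.
have tM : monoid_morphism t.
  by split=> [|x y]; apply: inj; rewrite -et ?rmorph1 // rmorphM [RHS]rmorphM !et.
pose t' : {rmorphism L -> L} := HB.pack t
  (GRing.isZmodMorphism.Build L L t tB) (GRing.isMonoidMorphism.Build L L t tM).
by exists t'.
Qed.

(** S_k(F) is stable under right multiplication by L, so S_k(G) = w theta(S_k(F)) is stable under
    right multiplication by theta(L). *)
Lemma theta_scal :
  exists t : {rmorphism L -> L}, forall l, theta (qscal sigma F l) = qscal
    sigma G (t l).
Proof.
pose f : {rmorphism L -> skew_quot sigma G} := theta \o qscal sigma F.
apply: (rmorph_of_qscal (f := f)) => l.
apply: (right_idealizer sigma_gen s_gt1 irrG m_range) => y.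
case/theta_code => x dx ->; apply/theta_code; exists (x * qscal sigma F l).
  exact: low_degree_scalr.
by rewrite rmorphM mulrA.
Qed.

(** The left-hand analogue: w theta(L) w^-1 stabilises S_k(G) on the left. *)
Lemma w_theta_scal :
  exists z : {rmorphism L -> L},
    forall l, w * theta (qscal sigma F l) = qscal sigma G (z l) * w.
Proof.
pose f0 l := w * theta (qscal sigma F l) * w'.
have f0B : zmod_morphism f0 by move=> x y; rewrite /f0 !rmorphB mulrBr mulrBl.
have f0M : monoid_morphism f0.
  split=> [|x y]; first by rewrite /f0 !rmorph1 mulr1.
  rewrite /f0 !rmorphM -!mulrA; do 2!congr (_ * _).
  by rewrite [w' * _]mulrA w'w mul1r.
pose f : {rmorphism L -> skew_quot sigma G} := HB.pack f0
  (GRing.isZmodMorphism.Build L _ f0 f0B) (GRing.isMonoidMorphism.Build L _ f0 f0M).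
have [l|z ez] := rmorph_of_qscal (f := f).
  apply: (left_idealizer sigma_gen s_gt1 irrG m_range) => y.
  case/theta_code => x dx ->; apply/theta_code; exists (qscal sigma F l * x).
    exact: low_degree_scall.
  by rewrite /= /f0 rmorphM -!mulrA [w' * _]mulrA w'w mul1r.
by exists z => l; rewrite -ez /= /f0 -mulrA w'w mulr1.
Qed.

Lemma theta_K_rmorph (t : {rmorphism L -> L}) :
    (forall l, theta (qscal sigma F l) = qscal sigma G (t l)) ->
  forall c : K, t c%:A = (h c)%:A.
Proof. by move=> et c; have := theta_K c;
  rewrite et => /(qscal_inj s_gt1 irrG). Qed.

Lemma qscal_central (H : {poly K}) (c : K) (y : skew_quot sigma H) :
  qscal sigma H c%:A * y = y * qscal sigma H c%:A.
Proof.
rewrite -[y]qrepK (qpiE _ _ (leqnn _)) mulr_sumr mulr_suml; apply: eq_bigr => i _.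
rewrite mulrA -rmorphM mulrC -[RHS]mulrA qX_scal mulrA -rmorphM.
by congr (qscal _ _ (_ * _) * _); rewrite iter_sigma -in_algE rmorph_alg.
Qed.

(** The two endomorphisms of L both extend [h], so they differ by a power of [sigma]; thus [w] is
    homogeneous of degree [i]. *)
Lemma twisting_index : exists t : {rmorphism L -> L}, exists i,
  (forall l, theta (qscal sigma F l) = qscal sigma G (t l)) /\
  (forall l, w * theta (qscal sigma F l) = qscal sigma G (iter i sigma (t l)) * w).
Proof.
have [t et] := theta_scal; have [z ez] := w_theta_scal.
have tK := theta_K_rmorph et.
have zK c : z c%:A = (h c)%:A.
  apply: (@qscal_inj _ _ sigma _ _ s_gt1 irrG).
  by rewrite -[LHS]mulr1 -ww' mulrA -ez theta_K -qscal_central -mulrA ww' mulr1.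
have [i ei] := rmorph_twist sigma_gen p_prime r_gt0 card_K tK zK.
by exists t, i; split=> // l; rewrite ez ei.
Qed.

(** A homogeneous y in S_k(G) is w theta(f) with f supported on one residue class. Then y theta(X) =
    w theta(f X) can leave the code only if f has a term in X^(m-1), and y theta(X^-1) only if f has
    a constant term; [e0] and [e1] are the corresponding degrees of y. *)
Lemma theta_shift : exists e0 e1 x',
  [/\ x' * qX sigma F = 1, qX sigma F * x' = 1,
    forall e y, e <> e0 %[mod n] -> has_type e y -> low_degree m y ->
      low_degree m (y * theta (qX sigma F)) &
    forall e y, e <> e1 %[mod n] -> has_type e y -> low_degree m y ->
      low_degree m (y * theta x')].
Proof.
have [t [i [et ez]]] := twisting_index.
have [x' x'x xx'] := qX_unit sigma s_gt1 irrF.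
have /andP[m0 m_sn] := m_range.
exists (m.-1 + i)%N, i, x'.
have key e y : has_type e y -> low_degree m y -> exists2 f : {poly L},
    (size f <= m)%N & y = w * theta (qpi sigma F f) /\
    forall j, f`_j != 0 -> (j + i = e %[mod n])%N.
  move=> ty /theta_code[x [f sf ->] ey]; exists f => //; split=> // j fj.
  (* [c] is e - i modulo n, written without subtraction. *)
  pose c := (e + i * n.-1)%N.
  have ci : (c + i = e %[mod n])%N.
    by rewrite /c -addnA -mulnSr prednK ?dimL_gt0 // addnC modnMDl.
  suff tf : has_type c (qpi sigma F f).
    have sf' : (size f <= s * n)%N := leq_trans sf (ltnW m_sn).
    by rewrite -modnDml (has_type_coef sigma_gen irrF sf' tf fj) modnDml.
  move=> l; apply: theta_inj; rewrite !rmorphM.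
  have winj (u v : skew_quot sigma G) : w * u = w * v -> u = v.
    by move=> e'; rewrite -[u]mul1r -w'w -mulrA e' mulrA w'w mul1r.
  apply: winj; rewrite [LHS]mulrA -ey [RHS]mulrA ez -[RHS]mulrA -ey et ty.
  congr (qscal sigma G _ * _).
  rewrite (rmorph_sigma sigma p_prime r_gt0 card_K) -iterD addnC.
  by apply: (iter_sigma_mod sigma_gen).
split=> // e y ne ty dy; have [f sf [ey fj]] := key e y ty dy; apply/theta_code.
  exists (qpi sigma F f * qX sigma F); last by rewrite rmorphM mulrA -ey.
  exists (f * 'X); last by rewrite -qpiM -[X in skewM _ X]expr1 skew_mul_Xn.
  apply/leq_sizeP => j mj; rewrite coefMX; case: eqP => // j0.
  have [ejm|njm] := eqVneq j.-1 m.-1; last first.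
    rewrite nth_default // (leq_trans sf) //.
    by move: mj njm m0 j0; move: (s * k)%N => M; clear; lia.
  by rewrite ejm; apply/eqP/negPn/negP => /fj h'; case: ne.
exists (qpi sigma F f * x'); last by rewrite rmorphM mulrA -ey.
have ef : f = \poly_(j < m.-1) f`_j.+1 * 'X.
  apply/polyP => -[|j]; rewrite coefMX /=.
    by apply/eqP/negPn/negP => /fj h'; case: ne.
  rewrite coef_poly; case: ltnP => // h'; rewrite nth_default // (leq_trans sf) //.
  by move: h' m0; move: (s * k)%N => M; clear; lia.
exists (\poly_(j < m.-1) f`_j.+1);
  first by rewrite (leq_trans (size_poly _ _)) ?leq_pred.
rewrite [in LHS]ef -[\poly_(_ < _) _ * 'X]/(_ * 'X^1) -(skew_mul_Xn sigma) qpiM.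
by rewrite -mulrA xx' mulr1.
Qed.


Lemma skew_inv_scal (H : {poly K}) (x x' : skew_quot sigma H) :
    x * x' = 1 -> x' * x = 1 -> has_type 1 x ->
  forall l, x' * qscal sigma H (sigma l) = qscal sigma H l * x'.
Proof.
move=> xx' x'x tx l.
have e : x' * (qscal sigma H (sigma l) * x) = qscal sigma H l.
  by have := tx l; rewrite /= => <-; rewrite mulrA x'x mul1r.
by rewrite -[in RHS]e -!mulrA xx' mulr1.
Qed.

Lemma qpi_comp_XnE (H D : {poly K}) N : (size D <= N)%N ->
  qpi sigma H (comp_Xn L D) = \sum_(i < N) qscal sigma H (D`_i)%:A * qX sigma H
    ^+ (n * i).
Proof.
move=> sD; transitivity (qpi sigma H (\sum_(i < N) (D`_i)%:A *: 'X^(n * i))).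
  congr (qpi _ _ _); rewrite [D in LHS](poly_pad_size sD) raddf_sum.
  apply: eq_bigr => i _ /=.
  by rewrite /comp_Xn map_polyZ map_polyXn comp_polyZ comp_Xn_poly -exprM.
by rewrite raddf_sum; apply: eq_bigr => i _ /=; rewrite qpiZ qpiXn.
Qed.

(** The remainder of D modulo G, evaluated at X^n, is already reduced, so it vanishes in the
    quotient only if it is zero. *)
Lemma qpi_comp_Xn_dvd (D : {poly K}) : qpi sigma G (comp_Xn L D) = 0 -> G %| D.
Proof.
have /and3P[_ /eqP sG _] := irrG.
have G0 : G != 0 by rewrite -size_poly_eq0 sG.
move=> D0; have r0 : qpi sigma G (comp_Xn L (D %% G)) = 0.
  have -> : D %% G = D - D %/ G * G by rewrite {2}(divp_eq D G) addrC addKr.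
  rewrite rmorphB rmorphM raddfB /= D0 sub0r -(skew_mul_comp_Xn sigma) qpiM.
  by rewrite qpi_comp_Xn mulr0 oppr0.
rewrite /dvdp; apply/negPn/negP => rn0.
have rs : (size (D %% G)%R <= s)%N by rewrite -ltnS -sG ltn_modp.
have s0 : (0 < size (D %% G)%R)%N by rewrite size_poly_gt0.
have sc : (size (comp_Xn L (D %% G)%R) <= s * n)%N.
  rewrite size_comp_Xn //; have : ((size (D %% G)%R).-1 * n + n <= s * n)%N.
    by rewrite -mulSnr leq_mul2r prednK // rs orbT.
  by apply: leq_trans; rewrite -addn1 leq_add2l dimL_gt0.
have : comp_Xn L (D %% G) = 0.
  apply: (@qpi_inj _ _ sigma _ _ irrG _ _ sc); first by rewrite size_poly0.
  by rewrite r0; symmetry; exact: (raddf0 (qpi sigma G)).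
by move/eqP; rewrite -size_poly_eq0 size_comp_Xn.
Qed.

(** X^n has minimal polynomial G over K, so a relation of degree s is a constant multiple of G; as G
    is monic, the constant is [c s]. *)
Lemma proportional_of_root (c : nat -> K) : c s != 0 ->
    \sum_(i < s.+1) qscal sigma G (c i)%:A * qX sigma G ^+ (n * i) = 0 ->
  forall i, (i <= s)%N -> c i = c s * G`_i.
Proof.
move=> cs c0; pose D := \poly_(i < s.+1) c i.
have sD : size D = s.+1 by rewrite size_poly_eq.
have /and3P[mG /eqP sG _] := irrG.
have : G %| D.
  apply: qpi_comp_Xn_dvd; rewrite (qpi_comp_XnE _ (eq_leq sD)) -[RHS]c0.
  by apply: eq_bigr => i _; rewrite coef_poly ltn_ord.
case/dvdpP => q eD i is'.
have q0 : q != 0 by apply: contra_eq_neq sD => q0; rewrite eD q0 mul0r size_poly0.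
have : size q = 1%N.
  have := sD; rewrite eD size_Mmonic // sG addnS /= => /eqP.
  by rewrite -[X in _ == X]add1n eqn_add2r => /eqP.
move/eqP/size_poly1P => [a a0 eq].
have Di j : (j <= s)%N -> c j = a * G`_j.
  by move=> js; have := coef_poly s.+1 c j;
    rewrite ltnS js -/D eD eq mul_polyC coefZ.
have Gs : G`_s = 1 by move/monicP: mG; rewrite lead_coefE sG.
by rewrite !Di // Gs mulr1.
Qed.

Lemma theta_relation :
  \sum_(i < s.+1) qscal sigma G (h F`_i)%:A * theta (qX sigma F) ^+ (n * i) = 0.
Proof.
have /and3P[_ /eqP sF _] := irrF.
rewrite -[RHS](rmorph0 theta) -[in RHS](qpi_comp_Xn sigma F) (qpi_comp_XnE _
  (eq_leq sF)).
rewrite raddf_sum; apply: eq_bigr => i _ /=.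
by rewrite rmorphM theta_K rmorphXn.
Qed.

Lemma h_neq0 c : c != 0 -> h c != 0.
Proof.
apply: contraNneq => hc; have := theta_K c; rewrite hc scale0r rmorph0.
rewrite -(rmorph0 theta) => /theta_inj; rewrite -(rmorph0 (qscal sigma F)).
by move/(qscal_inj s_gt1 irrF)/eqP; rewrite scaler_eq0 oner_eq0 orbF.
Qed.

Lemma norm_in_base (a : L) :
  exists c : K, \prod_(j < n) iter j sigma a = c%:A.
Proof.
apply: (sigma_fixed sigma_gen); have [n' en] : exists n', n = n'.+1.
  by exists n.-1; rewrite prednK ?dimL_gt0.
have sn : iter n sigma a = a.
  by rewrite (@iter_sigma_mod _ _ _ sigma_gen n 0) // modnn mod0n.
move: sn; rewrite en => sn.
rewrite rmorph_prod big_ord_recr /= -iterS sn [RHS]big_ord_recl mulrC.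
by congr (_ * _); apply: eq_bigr => j _; rewrite /= -iterS.
Qed.

Lemma expr_scal_qX (H : {poly K}) a j :
  (qscal sigma H a * qX sigma H) ^+ j =
  qscal sigma H (\prod_(l < j) iter l sigma a) * qX sigma H ^+ j.
Proof.
elim: j => [|j IH]; first by rewrite big_ord0 !expr0 rmorph1 mulr1.
rewrite exprSr IH big_ord_recr qscalM -!mulrA; congr (_ * _).
by rewrite mulrA qX_scal -mulrA -exprSr.
Qed.

(** For n = 2 one has k = 1, so m = s, and theta(X)^-1 also has degree 1 modulo 2, which makes
    [inverse_pair_quadratic] applicable. For n > 2 [degree_alternative] suffices. *)
Lemma theta_qX :
  (exists2 a, a != 0 & theta (qX sigma F) = qscal sigma G a * qX sigma G) \/
  (n = 2%N /\ exists2 b, b != 0 & qX sigma G * theta (qX sigma F) = qscal sigma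
    G b).
Proof.
have [e0 [e1 [x' [x'x xx' sh sh']]]] := theta_shift.
have [t [i [et _]]] := twisting_index.
pose u := theta (qX sigma F); pose u' := theta x'.
have uu' : u * u' = 1 by rewrite -rmorphM xx' rmorph1.
have u'u : u' * u = 1 by rewrite -rmorphM x'x rmorph1.
have tu : has_type 1 u.
  move=> l; have [l' <-] := rmorph_surj p_prime r_gt0 card_K t l.
  rewrite -et -rmorphM -[qX _ _]expr1 qX_scal rmorphM et expr1.
  by rewrite (rmorph_sigma sigma p_prime r_gt0 card_K).
have [n2|n2] := eqVneq n 2%N.
  have k1 : k = 1%N by move: k_range; rewrite n2; lia.
  rewrite k1 muln1 in sh sh'.
  have tu' : has_type 1 u'.
    move=> l; have := skew_inv_scal uu' u'u tu (sigma l) => <-.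
    congr (_ * qscal _ _ _).
    by rewrite -[RHS]/(iter 2 sigma l) (@iter_sigma_mod _ _ _ sigma_gen 2 0) // n2.
  have [] := inverse_pair_quadratic sigma_gen s_gt1 irrG n2 uu' u'u tu tu'
    sh sh'.
    by left.
  by right; split.
left; pose g := qrep u.
have sg : (size g <= s * n)%N by exact: size_qrep.
have ug : u = qpi sigma G g by rewrite qrepK.
have g0 : g != 0.
  apply: contra_neq (skew_one_neq0 irrG) => g0.
  by rewrite -uu' ug g0 raddf0 mul0r.
have [//|[n2' _]] := degree_alternative sigma_gen s_gt1 irrG m_bound sg ug g0
  tu sh n_gt1.
by rewrite n2' eqxx in n2.
Qed.

(** As theta(X)^n is N(a) X^n or N(b) X^-n, applying [theta] to F(X^n) = 0 gives a relation of
    degree s in X^n or X^-n, which is compared with G. *)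
Lemma equivalent_coefs : exists2 c : K, c != 0 &
  (forall i, (i <= s)%N -> h F`_i * c ^+ i = h F`_s * c ^+ s * G`_i) \/
  (n = 2%N /\ forall i, (i <= s)%N ->
    h F`_(s - i) * c ^+ (s - i) = h F`_0 * G`_i).
Proof.
have /and3P[mF /eqP sF _] := irrF.
have hs : h F`_s != 0.
  by apply: h_neq0; rewrite -[s]/(s.+1.-1) -sF -lead_coefE (monicP mF) oner_neq0.
have h0 : h F`_0 != 0 by apply: h_neq0; exact: irr_coef0 irrF.
have nz (a : L) : a != 0 -> forall c : K, \prod_(j < n) iter j sigma a = c%:A
  -> c != 0.
  move=> a0 c ec; apply/eqP => c0; have /eqP := ec; rewrite c0 scale0r.
  by apply/negP/prodf_neq0 => j _; rewrite iter_sigma fmorph_eq0.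
have rel := theta_relation.
case: theta_qX => [[a a0 ea]|[n2 [b b0 eb]]].
  have [c ec] := norm_in_base a; have c0 := nz _ a0 _ ec; exists c => //; left.
  apply: (proportional_of_root (c := fun i => h F`_i * c ^+ i)).
    by rewrite mulf_neq0 ?expf_neq0.
  rewrite -[RHS]rel; apply: eq_bigr => i _.
  rewrite ea [(_ * _) ^+ (n * i)]exprM expr_scal_qX ec exprMn_comm;
    last exact: qscal_central.
  rewrite -exprM -qscalXn mulrA -qscalM; congr (qscal _ _ _ * _).
  by rewrite -!in_algE rmorphM rmorphXn.
have [c ec] := norm_in_base b; have c0 := nz _ b0 _ ec; exists c => //; right.
split=> //.
have [xi xix xxi] := qX_unit sigma s_gt1 irrG.
have sb2 : sigma (sigma b) = b.
  by rewrite -[LHS]/(iter 2 sigma b) (@iter_sigma_mod _ _ _ sigma_gen 2 0) // n2.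
have xib : xi * qscal sigma G b = qscal sigma G (sigma b) * xi.
  have := skew_inv_scal xxi xix (has_typeXn sigma G 1 : has_type 1 (qX sigma
    G)) (sigma b).
  by rewrite sb2.
have eu : theta (qX sigma F) = qscal sigma G (sigma b) * xi.
  by rewrite -xib -eb mulrA xix mul1r.
have eu2 : theta (qX sigma F) ^+ n = qscal sigma G c%:A * xi ^+ n.
  have cE : c%:A = sigma b * b.
    by rewrite -ec n2 !big_ord_recl big_ord0 mulr1 /= mulrC.
  have e := skew_inv_scal xxi xix (has_typeXn sigma G 1 : has_type 1 (qX sigma
    G)) b.
  rewrite n2 2!expr2 eu cE qscalM -[LHS]mulrA [xi * (_ * _)]mulrA e.
  by rewrite -!mulrA.
have xiX j : xi ^+ j * qX sigma G ^+ j = 1.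
  elim: j => [|j IH]; first by rewrite !expr0 mulr1.
  by rewrite exprSr exprS -mulrA [X in _ * X]mulrA xix mul1r.
have cs : h F`_(s - s) * c ^+ (s - s) != 0 by rewrite subnn expr0 mulr1.
have := proportional_of_root (c := fun i => h F`_(s - i) * c ^+ (s - i)) cs.
rewrite subnn expr0 mulr1; apply.
(* Multiplication by X^(n s) turns the relation in X^-n into one in X^n with reversed
   coefficients. *)
transitivity (\sum_(i < s.+1) qscal sigma G (h F`_i)%:A *
    theta (qX sigma F) ^+ (n * i) * qX sigma G ^+ (n * s)).
  rewrite [LHS](reindex_inj rev_ord_inj); apply: eq_bigr => i _ /=.
  have is' : (i <= s)%N by rewrite -ltnS.
  rewrite subSS subKn // -mulrA [theta _ ^+ _]exprM eu2 exprMn_comm;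
    last exact: qscal_central.
  rewrite -exprM -qscalXn -[in RHS]mulrA.
  have -> : (n * s = n * i + n * (s - i))%N by rewrite -mulnDr subnKC.
  rewrite exprD [xi ^+ _ * _]mulrA xiX mul1r mulrA -qscalM.
  by congr (qscal _ _ _ * _); rewrite -!in_algE rmorphM rmorphXn.
by rewrite -mulr_suml rel mul0r.
Qed.

End OnlyIf.

(** * Twisted polynomials give equivalent codes *)
Section If.

Variables (K : finFieldType) (L : splittingFieldType K) (sigma : gal_of {:L}).
Hypothesis sigma_gen : generator 'Gal({:L} / 1)%g sigma.
Local Notation n := (\dim {:L}).
Local Notation skewM := (skew_mul (gal_repr sigma)).
Variables (p r : nat).
Hypotheses (p_prime : prime p) (r_gt0 : (0 < r)%N) (card_K : #|K| = (p ^ r)%N).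
Variables (s : nat) (F G : {poly K}).
Hypotheses (s_gt1 : (1 < s)%N).
Hypotheses (irrF : irr_poly_pred s F) (irrG : irr_poly_pred s G).
Variables (h : {rmorphism K -> K}).
Local Notation qscalF := (qscal sigma F).
Local Notation qscalG := (qscal sigma G).
Local Notation qXG := (qX sigma G).

Lemma frobenius_extension :
  exists t : {rmorphism L -> L}, forall c : K, t c%:A = (h c)%:A.
Proof.
have pK := card_finPcharP card_K p_prime.
have [b _ eb] := rmorph_frobenius h pK card_K r_gt0.
have pL : p \in [pchar L] by rewrite pchar_lalg.
pose t : {rmorphism L -> L} := iter b (pFrobenius_aut pL).
have et x : t x = x ^+ (p ^ b).
  rewrite /t; elim: b {eb t} => [|b IH] /=; first by rewrite expr1.
  by rewrite IH pFrobenius_autE -exprM expnSr.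
by exists t => c; rewrite et eb -!in_algE -rmorphXn.
Qed.

(** f -> w theta(f) permutes the monomials of degree below N through [rho], up to nonzero factors
    and bijective twists of coefficients. [rho] will be the identity for scalings and the reversal
    for iota. *)
Lemma semilinear_sweep (theta : {rmorphism skew_quot sigma F -> skew_quot sigma G})
    (t z : {rmorphism L -> L}) (x w : skew_quot sigma G) N
    (rho : 'I_N -> 'I_N) (c : 'I_N -> L) :
    (forall l, theta (qscalF l) = qscalG (t l)) -> theta (qX sigma F) = x ->
    (forall l, w * qscalG l = qscalG (z l) * w) ->
    involutive rho -> (forall j, c j != 0) ->
    (forall j : 'I_N, w * x ^+ j = qscalG (c j) * qXG ^+ rho j) ->
  forall y, low_degree N y <-> exists2 f, low_degree N f & y = w * theta f.
Proof.
move=> et ex ez rhoK c0 ec y.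
have wE (q : {poly L}) : (size q <= N)%N ->
    w * theta (qpi sigma F q) =
    \sum_(j < N) qscalG (z (t q`_j) * c j) * qXG ^+ rho j.
  move=> sq; rewrite (qpiE _ _ sq) rmorph_sum mulr_sumr; apply: eq_bigr => j _ /=.
  by rewrite rmorphM rmorphXn et ex mulrA ez -mulrA ec mulrA -rmorphM.
split=> [[q sq ->]|[f [q sq ->] ->]].
  have /boolp.choice[inv zt] l : exists l', z (t l') = l.
    have [l1 <-] := rmorph_surj p_prime r_gt0 card_K z l.
    by have [l2 <-] := rmorph_surj p_prime r_gt0 card_K t l1; exists l2.
  pose f := \poly_(j < N) (if insub j is Some j' then inv (q`_(rho j') / c j')
    else 0).
  exists (qpi sigma F f); first by exists f; rewrite ?size_poly.
  rewrite wE ?size_poly // (qpiE _ _ sq) (reindex_inj (inv_inj rhoK)).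
  apply: eq_bigr => j _; rewrite coef_poly ltn_ord valK zt.
  by rewrite divfK.
rewrite wE //; exists (\sum_(j < N) (z (t q`_j) * c j) *: 'X^(rho j)).
  apply: (leq_trans (size_sum _ _ _)); apply/bigmax_leqP => j _.
  by rewrite (leq_trans (size_scale_leq _ _)) // size_polyXn.
by rewrite raddf_sum; apply: eq_bigr => j _ /=; rewrite qpiZ qpiXn.
Qed.

Lemma bijective_of_sweep (theta : {rmorphism skew_quot sigma F -> skew_quot
  sigma G})
    (w w' : skew_quot sigma G) : w' * w = 1 ->
    (forall y, low_degree (s * n) y <->
      exists2 f, low_degree (s * n) f & y = w * theta f) ->
  bijective theta.
Proof.
move=> w'w sweep.
have inj := skew_quot_hom_inj sigma_gen s_gt1 irrF (skew_one_neq0 sigma s_gt1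
  irrG) (Phi := theta).
have /boolp.choice[inv thetaK] y : exists x, theta x = y.
  have /sweep[f _ ef] : low_degree (s * n) (w * y).
    by exists (qrep (w * y)); rewrite ?size_qrep ?qrepK.
  by exists f; rewrite -[LHS]mul1r -w'w -mulrA -ef mulrA w'w mul1r.
by exists inv => // y; apply: inj.
Qed.

(** X goes to u X with N(u) = a^-1, so X^n goes to a^-1 X^n, and F^h(a^-1 Y) = a^-s G(Y). *)
Lemma twist_scale_equiv m (a : K) : a != 0 ->
    (forall i, (i <= s)%N -> G`_i = a ^+ s * a ^- i * h F`_i) ->
  exists theta : {rmorphism skew_quot sigma F -> skew_quot sigma G},
    [/\ bijective theta, forall c, theta (qscalF c%:A) = qscalG (h c)%:A &
      forall y, low_degree m y <-> exists2 f, low_degree m f & y = 1 * theta f].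
Proof.
move=> a0 eG; have [t et] := frobenius_extension.
have [u u0 Nu] := norm_surj sigma_gen (invr_neq0 a0).
have /and3P[_ /eqP sF _] := irrF; have /and3P[_ /eqP sG _] := irrG.
pose f : {rmorphism L -> skew_quot sigma G} := qscalG \o t.
pose x := qscalG u * qXG.
have xf l : x * f l = f (sigma l) * x.
  rewrite /x /= -mulrA -[qXG]expr1 qX_scal !mulrA -!qscalM /=.
  by rewrite (rmorph_sigma sigma p_prime r_gt0 card_K t 1) mulrC.
have Fx : \sum_(i < size F) f (F`_i)%:A * x ^+ (n * i) = 0.
  rewrite sF -[RHS](mulr0 (qscalG (a ^- s)%:A)) -[in RHS](qpi_comp_Xn sigma G).
  rewrite (qpi_comp_XnE sigma _ (eq_leq sG)) mulr_sumr; apply: eq_bigr => i _ /=.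
  rewrite et [x ^+ _]exprM (expr_scal_qX sigma) Nu exprMn_comm;
    last exact: qscal_central.
  rewrite -exprM -qscalXn !mulrA -!qscalM; congr (qscal _ _ _ * _).
  rewrite -!in_algE -rmorphXn -!rmorphM eG -1?ltnS //; congr (in_alg _ _).
  rewrite !mulrA mulVf ?expf_neq0 // mul1r mulrC -exprVn //.
have [theta thetaE] := skew_quot_hom xf Fx; exists theta.
have eS l : theta (qscalF l) = qscalG (t l).
  by rewrite thetaE -alg_polyC skew_evalZ -(expr0 'X) skew_evalXn expr0 mulr1.
have eX : theta (qX sigma F) = x.
  by rewrite thetaE -(expr1 'X) skew_evalXn expr1.
have sweep' N y : low_degree N y <-> exists2 f, low_degree N f & y = 1 * theta f.
  apply: (semilinear_sweep (z := (idfun : {rmorphism L -> L})) (rho := id)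
    (c := fun j => \prod_(l < j) iter l sigma u) eS eX).
  - by move=> l; rewrite mul1r mulr1.
  - by move=> j.
  - by move=> j; apply/prodf_neq0 => l _; rewrite iter_sigma fmorph_eq0.
  by move=> j; rewrite mul1r [LHS]expr_scal_qX.
split=> [|c|]; last exact: sweep'.
  by apply: (bijective_of_sweep (w := 1) (w' := 1)) => //; rewrite mul1r.
by rewrite eS et.
Qed.

(** X goes to u X^-1 with N(u) = a, and Y^s F^h(a Y^-1) = F^h(0) G(Y). The factor w = X^(m-1)
    carries the powers X^-j with j < m back to degrees 0 to m - 1. *)
Lemma twist_recip_equiv m (a : K) : a != 0 -> n = 2%N ->
    (forall i, (i <= s)%N -> G`_i = a ^+ s * a ^- i * ((h F`_0)^-1 * h F`_(s -
      i))) ->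
  exists (theta : {rmorphism skew_quot sigma F -> skew_quot sigma G}) w w',
    [/\ bijective theta, forall c, theta (qscalF c%:A) = qscalG (h c)%:A,
      w * w' = 1, w' * w = 1 &
      forall y, low_degree m y <-> exists2 f, low_degree m f & y = w * theta f].
Proof.
move=> a0 n2 eG; have [t et] := frobenius_extension.
have [u u0 Nu] := norm_surj sigma_gen a0.
have /and3P[_ /eqP sF _] := irrF; have /and3P[_ /eqP sG _] := irrG.
have [xi xix xxi] := qX_unit sigma s_gt1 irrG.
have s2 l : sigma (sigma l) = l.
  by rewrite -[LHS]/(iter 2 sigma l) (@iter_sigma_mod _ _ _ sigma_gen 2 0) // n2.
have xi_scal l : xi * qscalG l = qscalG (sigma l) * xi.
  have := skew_inv_scal xxi xix (has_typeXn sigma G 1 : has_type 1 qXG) (sigma l).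
  by rewrite s2.
have xi_scaln j l : xi ^+ j * qscalG l = qscalG (iter j sigma l) * xi ^+ j.
  elim: j => [|j IH]; first by rewrite !expr0 mulr1 mul1r.
  by rewrite exprS -mulrA IH mulrA xi_scal -mulrA.
pose f : {rmorphism L -> skew_quot sigma G} := qscalG \o t.
pose x := qscalG u * xi.
have xf l : x * f l = f (sigma l) * x.
  rewrite /x /= -mulrA xi_scal !mulrA -!qscalM /=.
  by rewrite (rmorph_sigma sigma p_prime r_gt0 card_K t 1) mulrC.
have xj j : x ^+ j = qscalG (\prod_(l < j) iter l sigma u) * xi ^+ j.
  elim: j => [|j IH]; first by rewrite big_ord0 !expr0 rmorph1 mulr1.
  rewrite exprSr IH big_ord_recr qscalM -!mulrA; congr (_ * _).
  by rewrite mulrA xi_scaln -mulrA -exprSr.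
have Xxi j : qXG ^+ j * xi ^+ j = 1.
  elim: j => [|j IH]; first by rewrite !expr0 mulr1.
  by rewrite exprSr exprS -mulrA [X in _ * X]mulrA xxi mul1r.
have xiX j : xi ^+ j * qXG ^+ j = 1.
  elim: j => [|j IH]; first by rewrite !expr0 mulr1.
  by rewrite exprSr exprS -mulrA [X in _ * X]mulrA xix mul1r.
have F0 : h F`_0 != 0 by rewrite fmorph_eq0; exact: irr_coef0 irrF.
have Fx : \sum_(i < size F) f (F`_i)%:A * x ^+ (n * i) = 0.
  rewrite sF -[RHS](mul0r (xi ^+ (n * s))) -[in RHS](mulr0 (qscalG (h F`_0)%:A)).
  rewrite -[in RHS](qpi_comp_Xn sigma G).
  rewrite (qpi_comp_XnE sigma _ (eq_leq sG)) mulr_sumr mulr_suml.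
  rewrite [RHS](reindex_inj rev_ord_inj); apply: eq_bigr => i _ /=.
  have is' : (i <= s)%N by rewrite -ltnS.
  rewrite subSS et [x ^+ _]exprM xj Nu exprMn_comm; last exact: qscal_central.
  have -> : (n * s = n * (s - i) + n * i)%N by rewrite -mulnDr subnK.
  rewrite exprD -exprM -qscalXn -!mulrA [qXG ^+ _ * _]mulrA Xxi mul1r.
  rewrite !mulrA -!qscalM; congr (qscal _ _ _ * _).
  rewrite -!in_algE -rmorphXn -!rmorphM eG ?leq_subr // subKn //;
    congr (in_alg _ _).
  have -> : a ^+ s = a ^+ i * a ^+ (s - i) by rewrite -exprD subnKC.
  rewrite mulfK ?expf_neq0 // [in RHS]mulrCA mulVKf //.
  by rewrite mulrC.
have [theta thetaE] := skew_quot_hom xf Fx.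
have eS l : theta (qscalF l) = qscalG (t l).
  by rewrite thetaE -alg_polyC skew_evalZ -(expr0 'X) skew_evalXn expr0 mulr1.
have eX : theta (qX sigma F) = x.
  by rewrite thetaE -(expr1 'X) skew_evalXn expr1.
(* N = m gives the code, N = s n the bijectivity of [theta]. *)
have sweep N y : low_degree N y <->
    exists2 f, low_degree N f & y = qXG ^+ N.-1 * theta f.
  apply: (semilinear_sweep (z := iter N.-1 sigma) (rho := @rev_ord N)
    (c := fun j => iter N.-1 sigma (\prod_(l < j) iter l sigma u)) eS eX).
  - exact: qX_scal.
  - exact: rev_ordK.
  - move=> j; rewrite iter_sigma fmorph_eq0; apply/prodf_neq0 => l _.
    by rewrite iter_sigma fmorph_eq0.
  move=> j; rewrite xj mulrA qX_scal -mulrA; congr (_ * _).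
  have -> : N.-1 = (rev_ord j + j)%N by rewrite /=; have := ltn_ord j; lia.
  by rewrite exprD -mulrA Xxi mulr1.
exists theta, (qXG ^+ m.-1), (xi ^+ m.-1).
have bij : bijective theta := bijective_of_sweep (xiX _) (sweep (s * n)%N).
have thetaK c : theta (qscalF c%:A) = qscalG (h c)%:A by rewrite eS et.
by split; [exact: bij | exact: thetaK | exact: Xxi | exact: xiX | exact: sweep].
Qed.

End If.

(** * Counting orbits *)
Section Counting.

Variables (K : finFieldType) (s : nat) (s_gt1 : (1 < s)%N).

Lemma num_classes_orbits (A : {set twist K}) (R : irr_poly K s -> irr_poly K s
  -> Prop) :
    (forall x y, R x y <-> y \in orbit (irr_action K s_gt1) A x) ->
  num_classes R = num_orbits s_gt1 A.
Proof.
move=> RA; rewrite /num_classes /num_orbits /equivalence_partition;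
  congr #|pred_of_set _|.
apply: eq_imset => x; apply/setP => y; rewrite !inE /=.
by apply/asboolP/idP => /RA.
Qed.

Lemma card_le_orbits (A : {group twist K}) :
  (#|{: irr_poly K s}| <= num_orbits s_gt1 A * #|A|)%N.
Proof.
have actA : [acts A, on [set: irr_poly K s] | irr_action K s_gt1].
  by apply/actsP => a _ x; rewrite !inE.
rewrite -cardsT (card_partition (orbit_partition actA)) /num_orbits -sum_nat_const.
by apply: leq_sum => B /imsetP[x _ ->]; exact: leq_imset_card.
Qed.

Lemma ceil_le_card (N M z : nat) : (0 < M)%N -> (N <= z * M)%N ->
  (Num.ceil (N%:R / M%:R : rat) <= z%:Z)%R.
Proof.
move=> M0 NM; rewrite Num.Theory.ceil_le_int ?Num.Theory.num_real //.
rewrite Num.Theory.ler_pdivrMr ?Num.Theory.ltr0n //.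
by rewrite -[z%:~R]/(z%:R) -natrM Num.Theory.ler_nat.
Qed.

Variables (p r : nat).
Hypotheses (p_prime : prime p) (r_gt0 : (0 < r)%N) (card_K : #|K| = (p ^ r)%N).

Lemma frobenius_aut b : exists t : [subg field_auts_group K],
  forall c, aut_fun t c = c ^+ (p ^ b).
Proof.
have pK := card_finPcharP card_K p_prime.
pose f : {rmorphism K -> K} := iter b (pFrobenius_aut pK).
have ef x : f x = x ^+ (p ^ b).
  rewrite /f; elim: b {f} => [|b IH] /=; first by rewrite expr1.
  by rewrite IH pFrobenius_autE -exprM expnSr.
have ft : perm (fmorph_inj f) \in field_auts_group K.
  by apply/field_autsP; split=> [|x y|x y];
    rewrite !permE ?rmorph1 ?rmorphD ?rmorphM.
exists (subg _ (perm (fmorph_inj f))) => c.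
by rewrite /aut_fun subgK // permE ef.
Qed.

(** Each automorphism is x -> x^(p^j) for some j < r, and j determines it. *)
Lemma card_field_auts : (#|{: [subg field_auts_group K]}| <= r)%N.
Proof.
have pK := card_finPcharP card_K p_prime.
have /boolp.choice[f fE] (t : [subg field_auts_group K]) :
    exists j : 'I_r, forall x, aut_fun t x = x ^+ (p ^ j).
  have [j jr ej] := rmorph_frobenius (aut_fun t) pK card_K r_gt0.
  by exists (Ordinal jr).
rewrite -[X in (_ <= X)%N]card_ord; apply: (leq_card f) => t u ftu.
apply: val_inj; apply/permP => x.
by rewrite -[sgval t x]/(aut_fun t x) fE ftu -fE.
Qed.

Lemma card_calGhat n : (#|calGhat K n| <= (if n == 2%N then 2 else 1) * r *
  (#|K| - 1))%N.
Proof.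
set eps := (if _ then _ else _).
(* Index 1 in ['I_eps] stands for iota; for eps = 1 only index 0 remains. *)
pose f (x : {unit K} * 'I_eps * [subg field_auts_group K]) : twist K :=
  Twist x.1.1 (x.1.2 == 1%N :> nat) x.2.
apply: (@leq_trans #|f @: [set: _]%SET|).
  apply/subset_leq_card/fintype.subsetP => -[a e t]; rewrite inE /= => en.
  have h : (e < eps)%N by rewrite /eps; case: e en => /= [->|_] //; case: ifP.
  by apply/imsetP; exists (a, Ordinal h, t) => //; rewrite /f /=; case: (e) {h en}.
rewrite (leq_trans (leq_imset_card _ _)) // cardsT !card_prod card_ord.
rewrite -(cardsT {unit K}) card_finField_unit subn1.
by rewrite [(_ * eps)%N]mulnC [leqLHS]mulnAC leq_mul2r leq_mul2l
  card_field_auts !orbT.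
Qed.

Lemma card_calG n : (#|calG K n| <= (if n == 2%N then 2 else 1) * (#|K| - 1))%N.
Proof.
set eps := (if _ then _ else _).
pose f (x : {unit K} * 'I_eps) : twist K := Twist x.1 (x.2 == 1%N :> nat) 1%g.
apply: (@leq_trans #|f @: [set: _]%SET|).
  apply/subset_leq_card/fintype.subsetP => -[a e t];
    rewrite inE /= => /andP[en /eqP->].
  have h : (e < eps)%N by rewrite /eps; case: e en => /= [->|_] //; case: ifP.
  by apply/imsetP; exists (a, Ordinal h) => //; rewrite /f /=; case: (e) {h en}.
rewrite (leq_trans (leq_imset_card _ _)) // cardsT card_prod card_ord.
by rewrite -(cardsT {unit K}) card_finField_unit subn1 mulnC.
Qed.

End Counting.

(** * Matrix codes *)
Section Bridge.

Variables (K : finFieldType) (L : splittingFieldType K) (sigma : gal_of {:L}).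
Hypothesis sigma_gen : generator 'Gal({:L} / 1)%g sigma.
Local Notation n := (\dim {:L}).
Variables (p r : nat).
Hypotheses (p_prime : prime p) (r_gt0 : (0 < r)%N) (card_K : #|K| = (p ^ r)%N).
Variables (E : fieldExtType K) (s k : nat).
Hypotheses (s_gt1 : (1 < s)%N) (n_gt1 : (1 < n)%N) (k_range : (1 <= k <= n - 1)%N).
Hypothesis dim_E : \dim {:E} = s.

(** Matrix-free equivalence of codes, which keeps of rho only its restriction [h] to K. *)
Definition ring_equiv (F G : {poly K}) (h : K -> K) : Prop :=
  exists (theta : {rmorphism skew_quot sigma F -> skew_quot sigma G}) w w',
    [/\ w * w' = 1, w' * w = 1,
        forall c, theta (qscal sigma F c%:A) = qscal sigma G (h c)%:A &
        forall y, low_degree (s * k) y <->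
          exists2 x, low_degree (s * k) x & y = w * theta x].

(** U A V = (U V)(V^-1 A V): conjugation by V is absorbed in [theta], and U V becomes [w]. *)
Lemma ring_equiv_of_mx (F G : {poly K})
    (phi : {rmorphism skew_quot sigma F -> 'M[E]_n})
    (psi : {rmorphism skew_quot sigma G -> 'M[E]_n})
    (rho : {rmorphism E -> E}) (h : K -> K) (U V : 'M[E]_n) :
    is_alg_iso phi -> is_alg_iso psi -> (forall c : K, rho c%:A = (h c)%:A) ->
    U \in unitmx -> V \in unitmx ->
    (psi @` skew_code sigma s k G)%classic =
      mx_transform rho U V (phi @` skew_code sigma s k F)%classic ->
  ring_equiv F G h.
Proof.
move=> [phi_bij phiK] [[psi' psiK Kpsi] psiKc] rhoK uU uV eS.
have psi_inj : injective psi := can_inj psiK.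
pose f x := psi' (invmx V *m map_mx rho (phi x) *m V).
have fE x : psi (f x) = invmx V *m map_mx rho (phi x) *m V by exact: Kpsi.
have fB : zmod_morphism f.
  move=> x y; apply: psi_inj; rewrite rmorphB !fE rmorphB map_mxB.
  by rewrite mulmxBr mulmxBl.
have fM : monoid_morphism f.
  split=> [|x y]; apply: psi_inj; rewrite ?rmorph1 ?fE ?rmorph1.
    by rewrite -[X in _ *m X *m _]/(1%:M) mulmx1 mulVmx.
  rewrite [RHS]rmorphM !fE (rmorphM phi) -[map_mx rho (_ * _)]/(map_mx rho (phi
    x *m phi y)).
  rewrite map_mxM -[RHS]/(_ *m _) !mulmxA.
  by rewrite -[X in _ = X *m _ *m _]mulmxA mulmxV // mulmx1.
pose theta : {rmorphism skew_quot sigma F -> skew_quot sigma G} := HB.pack f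
  (GRing.isZmodMorphism.Build _ _ f fB) (GRing.isMonoidMorphism.Build _ _ f fM).
pose w := psi' (U *m V); pose w' := psi' (invmx V *m invmx U).
have wE x : psi (w * theta x) = U *m map_mx rho (phi x) *m V.
  rewrite rmorphM fE Kpsi -[LHS]/(_ *m _) !mulmxA.
  by rewrite -[U *m V *m invmx V]mulmxA mulmxV // mulmx1.
exists theta, w, w'; split.
- apply: psi_inj; rewrite rmorphM !Kpsi rmorph1 -[LHS]/(_ *m _) mulmxA.
  by rewrite -[U *m V *m _]mulmxA mulmxV // mulmx1 mulmxV.
- apply: psi_inj; rewrite rmorphM !Kpsi rmorph1 -[LHS]/(_ *m _) mulmxA.
  by rewrite -[_ *m invmx U *m _]mulmxA mulVmx // mulmx1 mulVmx.
- move=> c; apply: psi_inj; rewrite fE -!qscalE phiK psiKc map_scalar_mx /= rhoK.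
  by rewrite scalar_mxC -mulmxA mulVmx // mulmx1.
move=> y; split=> [dy|[x dx ey]].
  have : (psi @` skew_code sigma s k G)%classic (psi y).
    by exists y => //; apply/skew_codeP.
  rewrite eS => -[A [x /skew_codeP dx <-] e]; exists x => //.
  by apply: psi_inj; rewrite wE e.
have : (psi @` skew_code sigma s k G)%classic (psi y).
  rewrite eS; exists (phi x); first by exists x => //; apply/skew_codeP.
  by rewrite ey wE.
by case=> y' /skew_codeP dy' /psi_inj <-.
Qed.

(** Any [psi] will do, with phi = rho^-1 psi theta: the factor rho^-1 undoes [h] on constants, which
    makes [phi] K-linear. *)
Lemma mx_of_ring_equiv (F G : {poly K}) (irrG : irr_poly_pred s G)
    (theta : {rmorphism skew_quot sigma F -> skew_quot sigma G}) w w'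
    (rho rho' : {rmorphism E -> E}) (h : K -> K) :
    bijective theta -> w * w' = 1 -> w' * w = 1 ->
    (forall c, theta (qscal sigma F c%:A) = qscal sigma G (h c)%:A) ->
    (forall y, low_degree (s * k) y <->
          exists2 x, low_degree (s * k) x & y = w * theta x) ->
    cancel rho rho' -> cancel rho' rho -> (forall c : K, rho c%:A = (h c)%:A) ->
  exists (phi : {rmorphism skew_quot sigma F -> 'M[E]_n})
         (psi : {rmorphism skew_quot sigma G -> 'M[E]_n}) (U : 'M[E]_n),
    [/\ is_alg_iso phi, is_alg_iso psi, U \in unitmx &
        (psi @` skew_code sigma s k G)%classic =
          mx_transform rho U 1%:M (phi @` skew_code sigma s k F)%classic].
Proof.
move=> [theta' thetaK Ktheta] ww' w'w thetaC code rhoK Krho rhoC.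
have [psi [[psi' psiK Kpsi] psiC]] := skew_quot_matrix_iso sigma_gen s_gt1 irrG
  dim_E.
pose phi : {rmorphism skew_quot sigma F -> 'M[E]_n} := map_mx rho' \o (psi \o
  theta).
have mxK (A : 'M[E]_n) : map_mx rho (map_mx rho' A) = A.
  by apply/matrixP => i j; rewrite !mxE Krho.
have mxK' (A : 'M[E]_n) : map_mx rho' (map_mx rho A) = A.
  by apply/matrixP => i j; rewrite !mxE rhoK.
exists phi, psi, (psi w); split.
- split=> [|c].
    exists (fun A => theta' (psi' (map_mx rho A))) => [x|A] /=.
      by rewrite mxK psiK thetaK.
    by rewrite Ktheta Kpsi mxK'.
  by rewrite qscalE /= thetaC -qscalE psiC map_scalar_mx /= -rhoC rhoK.
- by split=> //; exists psi'.
- have h1 : psi w *m psi w' = 1%:M by rewrite -[LHS]/(psi w * psi w') -rmorphM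
  ww' rmorph1.
  by case: (mulmx1_unit h1).
have psi_inj : injective psi := can_inj psiK.
apply/seteqP; split=> [A [y /skew_codeP/code[x dx ey] <-]|A [B [x /skew_codeP
  dx <-] <-]].
  exists (phi x); first by exists x => //; apply/skew_codeP.
  by rewrite /= mxK mulmx1 ey rmorphM.
exists (w * theta x); first by apply/skew_codeP/code; exists x.
by rewrite /= mxK mulmx1 rmorphM.
Qed.

(** As F is monic, the coefficient relations say that G is F^t scaled by c^-1 or, when n = 2, the
    reciprocal of F^t scaled by c. *)
Lemma orbit_of_ring_equiv (F G : irr_poly K s) (t : [subg field_auts_group K]) :
  ring_equiv F G (aut_fun t) ->
  exists2 g, (g \in calGhat K n) && (tw_aut g == t) & G = irr_act s_gt1 F g.
Proof.
case=> theta [w [w' [ww' w'w thetaC code]]].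
have irrF := irr_valP F; have irrG := irr_valP G.
have [c c0 eG] := equivalent_coefs sigma_gen p_prime r_gt0 card_K s_gt1 n_gt1
  k_range
  irrF irrG ww' w'w thetaC code.
have /and3P[mF /eqP sF _] := irrF; have /and3P[_ /eqP sG _] := irrG.
have Fs : F`_s = 1 :> K by move/monicP: mF; rewrite lead_coefE sF.
have F0 : aut_fun t (F : {poly K})`_0 != 0.
  by rewrite fmorph_eq0; exact: irr_coef0 irrF.
case: eG => [eG|[n2 eG]].
  exists (Twist (finField_unit c0)^-1%g false t); first by rewrite inE /= eqxx.
  apply: val_inj; apply/polyP => i;
    rewrite /= /twist_poly coef_scale_poly coef_map /=.
  case: (leqP i s) => his; last first.
    by rewrite !nth_default ?sF ?sG // rmorph0 mulr0.
  have := eG i his; rewrite Fs rmorph1 mul1r => e.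
  apply: (mulfI (expf_neq0 s c0)); rewrite -e !mulrA.
  by rewrite !exprVn mulfV ?expf_neq0 // mul1r invrK mulrC.
exists (Twist (finField_unit c0) true t); first by rewrite inE /= n2 !eqxx.
apply: val_inj; apply/polyP => i; rewrite /= /twist_poly coef_scale_poly /=.
rewrite coef_recip_poly !coef_map /=.
case: (leqP i s) => his; last by rewrite mulr0 nth_default // sG.
apply: (mulfI F0); rewrite -(eG i his).
have -> : c ^+ s = c ^+ i * c ^+ (s - i) by rewrite -exprD subnKC.
rewrite [RHS]mulrCA mulVKf // mulrC; congr (_ * _).
by rewrite mulrAC mulfV ?mul1r // expf_neq0.
Qed.

Lemma ring_equiv_of_orbit (F G : irr_poly K s) g : g \in calGhat K n ->
    G = irr_act s_gt1 F g ->
  exists (theta : {rmorphism skew_quot sigma F -> skew_quot sigma G}) w w',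
    [/\ bijective theta,
        forall c, theta (qscal sigma F c%:A) = qscal sigma G (aut_fun (tw_aut
          g) c)%:A,
        w * w' = 1, w' * w = 1 &
        forall y, low_degree (s * k) y <->
          exists2 x, low_degree (s * k) x & y = w * theta x].
Proof.
rewrite inE => gn eG; have irrF := irr_valP F; have irrG := irr_valP G.
have eGi i : (G : {poly K})`_i = (twist_poly s F g)`_i by rewrite eG.
have a0 : val (tw_scal g) != 0 := unit_val_neq0 (tw_scal g).
have [ti|ti] := boolP (tw_inv g).
  have n2 : n = 2%N by move: gn; rewrite ti => /eqP.
  apply: (twist_recip_equiv sigma_gen p_prime r_gt0 card_K s_gt1 irrF irrG _ a0
    n2) => i his.
  by rewrite eGi /twist_poly ti coef_scale_poly coef_recip_poly his !coef_map.
have [i _|theta [bij thetaC code]] := twist_scale_equiv sigma_gen p_prime r_gt0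
  card_K
    s_gt1 irrF irrG (h := aut_fun (tw_aut g)) (s * k) a0.
  by rewrite eGi /twist_poly (negPf ti) coef_scale_poly coef_map.
by exists theta, 1, 1; rewrite mulr1; split.
Qed.

Lemma linear_equiv_orbit (F G : irr_poly K s) :
  code_linear_equiv sigma E n s k F G <-> G \in orbit (irr_action K s_gt1)
    (calG K n) F.
Proof.
split=> [[phi [psi [iphi ipsi [U [V [uU uV eS]]]]]]|/imsetP[g]].
  have : ring_equiv F G (aut_fun 1%g).
    apply: (ring_equiv_of_mx (rho := idfun) iphi ipsi _ uU uV eS) => c.
    by rewrite aut_fun1.
  case/orbit_of_ring_equiv => g /andP[gG /eqP g1] ->; apply/imsetP; exists g => //.
  by move: gG; rewrite !inE g1 eqxx andbT.
rewrite inE => /andP[gG /eqP g1] eG.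
have gG' : g \in calGhat K n by rewrite inE.
have [theta [w [w' [bij thetaC ww' w'w code]]]] := ring_equiv_of_orbit gG' eG.
have [phi [psi [U [iphi ipsi uU eS]]]] := mx_of_ring_equiv (irr_valP G)
  (rho := idfun) (rho' := idfun) bij ww' w'w thetaC code (fun=> erefl) (fun=> erefl)
  (fun c => ltac:(by rewrite g1 aut_fun1)).
by exists phi, psi; split=> //; exists U, 1%:M; rewrite unitmx1.
Qed.

(** rho is a power map, so it restricts to an automorphism of K. Conversely an automorphism of K
    extends to E as the same power map, invertible because it has finite order. *)
Lemma Gamma_equiv_orbit (F G : irr_poly K s) :
  code_Gamma_equiv sigma E n s k F G <->
  G \in orbit (irr_action K s_gt1) (calGhat K n) F.
Proof.
split=> [[phi [psi [iphi ipsi [U [V [rho [uU uV _ eS]]]]]]]|/imsetP[g gG eG]].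
  have [b eb] := rmorph_frobenius_ext p_prime r_gt0 card_K rho.
  have [t et] := frobenius_aut p_prime card_K b.
  have : ring_equiv F G (aut_fun t).
    apply: (ring_equiv_of_mx iphi ipsi _ uU uV eS) => c.
    by rewrite eb et -!in_algE -rmorphXn.
  case/orbit_of_ring_equiv => g /andP[gG _] ->; apply/imsetP.
  by exists g.
have [theta [w [w' [bij thetaC ww' w'w code]]]] := ring_equiv_of_orbit gG eG.
have [rho rhoC] := frobenius_extension (finvect_type E) p_prime r_gt0 card_K
  (aut_fun (tw_aut g)).
have [N N0 rhoN] := rmorph_iter_id p_prime r_gt0 card_K rho.
pose rho' : {rmorphism finvect_type E -> finvect_type E} := iter N.-1 rho.
have rhoK : cancel rho rho'.
  by move=> x; rewrite -[RHS]rhoN -[in RHS](prednK N0) iterSr.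
have Krho : cancel rho' rho.
  by move=> x; rewrite -[RHS]rhoN -[in RHS](prednK N0).
have [phi [psi [U [iphi ipsi uU eS]]]] := mx_of_ring_equiv (irr_valP G)
  (rho := (rho : {rmorphism E -> E})) (rho' := (rho' : {rmorphism E -> E}))
  bij ww' w'w thetaC code rhoK Krho rhoC.
exists phi, psi; split=> //; exists U, 1%:M, (rho : {rmorphism E -> E}).
by rewrite unitmx1; split=> //; exists rho'.
Qed.

End Bridge.

(** * Classes as orbits, and lower bounds from the group orders *)

Theorem theorem5p11 (p r q s n k : nat)
    (p_prime : prime p) (r_gt0 : (0 < r)%N) (q_def : q = (p ^ r)%N)
    (s_gt1 : (1 < s)%N) (n_gt1 : (1 < n)%N) (k_range : (1 <= k <= n - 1)%N)
    (K : finFieldType) (card_K : #|K| = q)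
    (L : splittingFieldType K) (dim_L : \dim {:L} = n)
    (sigma : gal_of {:L}) (sigma_gen : generator 'Gal({:L} / 1)%g sigma)
    (E : fieldExtType K) (dim_E : \dim {:E} = s)
    (eps : nat) (eps_def : eps = if n == 2%N then 2%N else 1%N) :
  (num_classes (fun F G : irr_poly K s => code_linear_equiv sigma E n s k F G)
     = num_orbits s_gt1 (calG K n) /\
   (Num.ceil (#|{: irr_poly K s}|%:R / (eps * (q - 1))%:R : rat)
     <= (num_classes (fun F G : irr_poly K s =>
           code_linear_equiv sigma E n s k F G))%:Z)%R) /\
  (num_classes (fun F G : irr_poly K s => code_Gamma_equiv sigma E n s k F G)
     = num_orbits s_gt1 (calGhat K n) /\
   (Num.ceil (#|{: irr_poly K s}|%:R / (eps * r * (q - 1))%:R : rat)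
     <= (num_classes (fun F G : irr_poly K s =>
           code_Gamma_equiv sigma E n s k F G))%:Z)%R).
Proof.
subst q n eps.
have cK : #|K| = (p ^ r)%N by [].
have q1 : (0 < #|K| - 1)%N by rewrite subn_gt0; exact: finNzRing_gt1.
have e1 := num_classes_orbits (linear_equiv_orbit sigma_gen p_prime r_gt0 cK
  s_gt1 n_gt1 k_range dim_E).
have e2 := num_classes_orbits (Gamma_equiv_orbit sigma_gen p_prime r_gt0 cK
  s_gt1 n_gt1 k_range dim_E).
rewrite e1 e2 -cK; split; split=> //; apply: ceil_le_card.
- by rewrite muln_gt0 q1 andbT; case: ifP.
- apply: (leq_trans (card_le_orbits s_gt1 (calG_group K (\dim {:L})))).
  by apply: leq_mul => //; exact: card_calG.
- by rewrite !muln_gt0 q1 r_gt0 !andbT; case: ifP.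
apply: (leq_trans (card_le_orbits s_gt1 (calGhat_group K (\dim {:L})))).
by apply: leq_mul => //; exact: (card_calGhat p_prime r_gt0 cK).
Qed.
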